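(* Let $\omega_0,\alpha,h,\omega_d,H>0$, $F^*\in\mathbb{R}$, $x^*\in\mathbb{R}^2$, $p\in(0.5,1)$, and let $F(x)=F^*-\tfrac12H|x-x^*|^2$. For $\omega>0$ consider the closed-loop Newton source seeking system with state $(x,d,\nu)\in\mathbb{R}^2\times\mathbb{R}_{>0}\times\mathbb{R}$: $$\dot x=\Big[\omega^{1-p}d(F(x)-\nu)\sin(\omega t)+\alpha\omega^p\cos(\omega t)\Big]\begin{bmatrix}\cos(\omega_0t)\\ \sin(\omega_0t)\end{bmatrix},$$ $$\dot d=\omega_d d\Big(1-d\frac{8\omega^2}{\alpha^2\omega^{2p}}(F(x)-\nu)\cos(2\omega t)\Big),\qquad\dot\nu=h(F(x)-\nu)$$ (i.e. the unicycle $\dot x=u_1[\cos\theta,\sin\theta]^\top$, $\dot\theta=u_2$ with $\theta=\omega_0t$, $u_2=\omega_0$, $u_1=cd(F(x)-\nu)\sin(\omega t)+\tilde\alpha\cos(\omega t)$, $c=\omega^{1-p}$, $\tilde\alpha=\alpha\omega^p$). Then the point $x=x^*$, $d=H^{-1}$, $\nu=F^*$ is semi-globally practically uniformly asymptotically stable on the set $\{d>0\}$, with parameter $\omega^{-1}$; precisely, in the error coordinates $e=(x-x^*,\ \ln(Hd),\ \nu-F^* )\in\mathbb{R}^4$ (defined for $d>0$), the origin is sGPUAS with parameter $\omega^{-1}$ in the sense defined below.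
   Context: Definition (sGPUAS with a single parameter $\omega^{-1}$). The origin of a system $\dot e=f(t,e,\omega)$ on $\mathbb{R}^n$ is semi-globally practically uniformly asymptotically stable (sGPUAS) with parameter $\omega^{-1}$ if for every pair of bounded neighborhoods $\mathcal{B},\mathcal{V}\subset\mathbb{R}^n$ of the origin there exist bounded neighborhoods $\mathcal{Q}\subset\mathcal{B}$ and $\mathcal{W}\supset\mathcal{V}$ of the origin and $\omega^*>0$ such that for every $\omega>\omega^*$ there exists $t_1\ge0$ such that for all $t_0\in\mathbb{R}$ the solutions satisfy: (1) $e(t_0)\in\mathcal{V}\Rightarrow e(t)\in\mathcal{W}$ for all $t\ge t_0$; (2) $e(t_0)\in\mathcal{Q}\Rightarrow e(t)\in\mathcal{B}$ for all $t\ge t_0$; (3) $e(t_0)\in\mathcal{V}\Rightarrow e(t)\in\mathcal{B}$ for all $t\ge t_0+t_1$. A neighborhood of a point is a connected open set containing a ball centered at that point. *)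

(* Defs.v *)
From HB Require Import structures.
From mathcomp Require Import all_boot all_order all_algebra.
From mathcomp Require Import all_classical all_reals all_analysis.
Set Implicit Arguments. Unset Strict Implicit. Unset Printing Implicit Defensive.
Import Order.TTheory GRing.Theory Num.Theory.
Import numFieldNormedType.Exports.
Local Open Scope classical_set_scope.
Local Open Scope ring_scope.

Definition eball0 {R : realType} (r : R) : set 'rV[R]_4 :=
  [set e | \sum_(i < 4) (e ord0 i) ^+ 2 < r ^+ 2].

Definition nbhd0 {R : realType} (U : set 'rV[R]_4) : Prop :=
  open U /\ connected U /\ exists2 r : R, 0 < r & eball0 r `<=` U.

Definition bnbhd0 {R : realType} (U : set 'rV[R]_4) : Prop :=
  nbhd0 U /\ bounded_set U.

(* sGPUAS with parameter omega^-1.  [sol w t0 T e] means: e : R -> R^4 is a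
   solution of the system with parameter w, defined on [t0, T).  *)
Definition sGPUAS {R : realType}
    (sol : R -> R -> R -> (R -> 'rV[R]_4) -> Prop) : Prop :=
  forall B V : set 'rV[R]_4, bnbhd0 B -> bnbhd0 V ->
  exists Q W : set 'rV[R]_4,
    [/\ bnbhd0 Q, Q `<=` B, bnbhd0 W & V `<=` W] /\
    exists2 wstar : R, 0 < wstar &
    forall w : R, wstar < w ->
    exists2 t1 : R, 0 <= t1 &
    forall (t0 T : R) (e : R -> 'rV[R]_4), sol w t0 T e ->
      [/\ (V (e t0) -> forall t, t0 <= t < T -> W (e t)),
          (Q (e t0) -> forall t, t0 <= t < T -> B (e t)) &
          (V (e t0) -> forall t, t0 + t1 <= t < T -> B (e t))].

Definition Fmap {R : realType} (Fs H xs1 xs2 y1 y2 : R) : R :=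
  Fs - H / 2 * ((y1 - xs1) ^+ 2 + (y2 - xs2) ^+ 2).

Definition nss_solution {R : realType}
    (w0 alpha h wd H Fs xs1 xs2 p w t0 T : R)
    (x1 x2 d nu : R -> R) : Prop :=
  let I := [set t : R | t0 <= t < T] in
  let g t := Fmap Fs H xs1 xs2 (x1 t) (x2 t) - nu t in
  let u1 t := powR w (1 - p) * d t * g t * sin (w * t)
              + alpha * powR w p * cos (w * t) in
  t0 < T /\
  [/\ {within I, continuous x1}, {within I, continuous x2},
      {within I, continuous d} & {within I, continuous nu}] /\
  (forall t, t0 <= t < T -> 0 < d t) /\
      (forall t, t0 < t < T ->
        [/\ is_derive t 1 x1 (u1 t * cos (w0 * t)),
            is_derive t 1 x2 (u1 t * sin (w0 * t)),
            is_derive t 1 d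
              (wd * d t * (1 - d t * (8 * w ^+ 2 / (alpha ^+ 2 * powR w (2 * p)))
                                   * g t * cos (2 * w * t))) &
            is_derive t 1 nu (h * g t)]).

Definition errvec {R : realType} (H Fs xs1 xs2 : R) (x1 x2 d nu : R -> R)
    (t : R) : 'rV[R]_4 :=
  \row_(i < 4) (match val i with
                | 0%N => x1 t - xs1
                | 1%N => x2 t - xs2
                | 2%N => ln (H * d t)
                | _ => nu t - Fs end).

Definition nss_err_sol {R : realType} (w0 alpha h wd H Fs xs1 xs2 p : R)
    (w t0 T : R) (e : R -> 'rV[R]_4) : Prop :=
  exists x1 x2 d nu : R -> R,
    nss_solution w0 alpha h wd H Fs xs1 xs2 p w t0 T x1 x2 d nu /\
    forall t, t0 <= t < T -> e t = errvec H Fs xs1 xs2 x1 x2 d nu t.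

(* Main.v *)
(** Write [A = alpha w^(p-1)] for the size of the fast oscillation of the
    position, [q = 1/d], [r = (cos w0 t, sin w0 t)], [phi = w t] and [G] for
    the gap [F(x) - nu]. As [w] grows, [A -> 0] because [p < 1], and
    [mu = 1/(A^2 w) -> 0] because [p > 1/2]. In these variables, up to a
    translation of the equilibrium,
      y' = (alpha/A d G sin phi + A w cos phi) r,
      q' = - wd (q - 8/A^2 G cos (2 phi)),   nu' = h G.
    After subtracting [A r sin phi] the position moves at rate [1/A] only.
    Products of such slow quantities with harmonics of [phi] are "null": each
    is the derivative of a small quantity up to a small error, uniformly over
    all trajectories confined to a compact box. The terms of size [1/A] need
    repeated integration by parts because [d] itself moves at rate [1/A^2], each
    step gaining one factor [mu]. They carry odd harmonics only, so no
    resonance occurs, and [mu^N/A -> 0] for [N] large.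
    What survives is the averaged system
      Z' = - (alpha H/2) d (Z.r) r,   Q' = - wd (Q - H),
      nu' = - h nu - (h H/2) |y|^2.
    In the rotating frame the first equation is a damped oscillator, which has
    a strict Lyapunov function. Gronwall estimates and a continuity argument
    keep the trajectory in the box, with exponential decay up to an
    arbitrarily small error. *)
Require Import Defs.
From HB Require Import structures.
From mathcomp Require Import all_boot all_order all_algebra.
From mathcomp Require Import all_classical all_reals all_analysis.
From mathcomp Require Import ring lra zify.
Import Order.TTheory GRing.Theory Num.Theory.
Import numFieldNormedType.Exports.
Local Open Scope classical_set_scope.
Local Open Scope ring_scope.

(** * Derivation rules and asymptotics uniform over trajectories *)

Section derivation_rules.
Context {R : realType}.
Implicit Types (f g : R -> R) (t a b : R).

Lemma is_derive_mul f g t a b : is_derive t 1 f a -> is_derive t 1 g b ->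
  is_derive t 1 (fun t => f t * g t) (a * g t + f t * b).
Proof.
move=> fa gb; apply: (is_derive_eq (is_deriveM fa gb)).
by rewrite /GRing.scale /=; ring.
Qed.

Lemma is_derive_add f g t a b : is_derive t 1 f a -> is_derive t 1 g b ->
  is_derive t 1 (fun t => f t + g t) (a + b).
Proof. by move=> fa gb; apply: (is_derive_eq (is_deriveD fa gb)). Qed.

Lemma is_derive_opp f t a : is_derive t 1 f a ->
  is_derive t 1 (fun t => - f t) (- a).
Proof. by move=> fa; apply: (is_derive_eq (is_deriveN fa)). Qed.

Lemma is_derive_const (k t : R) : is_derive t 1 (fun=> k) 0.
Proof. exact: is_derive_cst. Qed.

Lemma is_derive_pow f t a n : is_derive t 1 f a ->
  is_derive t 1 (fun t => f t ^+ n) (n%:R * f t ^+ n.-1 * a).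
Proof.
move=> fa; elim: n => [|n IH].
  by rewrite !mul0r; under eq_fun do rewrite expr0; exact: is_derive_cst.
under eq_fun do rewrite exprS.
apply: (is_derive_eq (is_derive_mul _ _ _ _ _ fa IH)) => /=.
by case: n {IH} => [|n] /=; rewrite ?exprS ?expr0 -?natr1; ring.
Qed.

Lemma is_derive_inv f t a : f t != 0 -> is_derive t 1 f a ->
  is_derive t 1 (fun t => (f t)^-1) (- a / f t ^+ 2).
Proof.
move=> ft0 fa; apply: (is_derive_eq (is_deriveV ft0 fa)).
by rewrite /GRing.scale /= mulrC mulrN mulNr.
Qed.

Lemma is_derive_affine (a b t : R) : is_derive t 1 (fun t => a * t + b) a.
Proof.
apply: (is_derive_eq (is_derive_add _ _ _ _ _
  (is_derive_mul _ _ _ _ _ (is_derive_const a t) (is_derive_id t 1))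
  (is_derive_const b t))); ring.
Qed.

Lemma is_derive_sin_affine (a b t : R) :
  is_derive t 1 (fun t => sin (a * t + b)) (a * cos (a * t + b)).
Proof.
have := @is_derive1_comp _ (@sin R) (fun t => a * t + b) t _ _
  (is_derive_sin (a * t + b)) (is_derive_affine a b t).
by move=> /is_derive_eq; apply; ring.
Qed.

Lemma is_derive_cos_affine (a b t : R) :
  is_derive t 1 (fun t => cos (a * t + b)) (- a * sin (a * t + b)).
Proof.
have := @is_derive1_comp _ (@cos R) (fun t => a * t + b) t _ _
  (is_derive_cos (a * t + b)) (is_derive_affine a b t).
by move=> /is_derive_eq; apply; ring.
Qed.

Lemma is_derive_sin_mul (a t : R) :
  is_derive t 1 (fun t => sin (a * t)) (a * cos (a * t)).
Proof.
by have := is_derive_sin_affine a 0 t; rewrite addr0; under eq_fun do rewrite addr0.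
Qed.

Lemma is_derive_cos_mul (a t : R) :
  is_derive t 1 (fun t => cos (a * t)) (- a * sin (a * t)).
Proof.
by have := is_derive_cos_affine a 0 t; rewrite addr0; under eq_fun do rewrite addr0.
Qed.

End derivation_rules.

(** * Bounded, small and null quantities *)

Section asymptotics.
Context {R : realType} {I : Type} (om : I -> R) (dom : I -> R -> Prop).
Implicit Types (f g c : I -> R -> R) (P Q S : I -> R -> Prop).

(* Uniformly in the trajectory [i] and in the time [t], for large frequency. *)
Definition evt P := exists w : R, forall i t, w < om i -> dom i t -> P i t.
Definition bdd f := exists C : R, evt (fun i t => `|f i t| <= C).
Definition small f := forall e : R, 0 < e -> evt (fun i t => `|f i t| <= e).
Definition der f g := evt (fun i t => is_derive t 1 (f i) (g i t)).
(** If [f] occurs in the derivative of a state, subtracting [c] from that state removes [f] up to a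
    small error and displaces the state only slightly. *)
Definition null f := exists c c',
  [/\ der c c', small c & small (fun i t => c' i t - f i t)].

Lemma evtW P : (forall i t, dom i t -> P i t) -> evt P.
Proof. by move=> h; exists 0 => i t _; apply: h. Qed.

Lemma evt_imp P Q : (forall i t, dom i t -> P i t -> Q i t) -> evt P -> evt Q.
Proof. by move=> h [w hw]; exists w => i t wi di; apply: h (hw _ _ wi di). Qed.

Lemma evt2 P Q S : (forall i t, dom i t -> P i t -> Q i t -> S i t) ->
  evt P -> evt Q -> evt S.
Proof.
move=> h [w hw] [v hv]; exists (Num.max w v) => i t.
by rewrite gt_max => /andP[wi vi] di; apply: h (hw _ _ wi di) (hv _ _ vi di).
Qed.

Lemma evt_and P Q : evt P -> evt Q -> evt (fun i t => P i t /\ Q i t).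
Proof. by apply: evt2 => i t _; split. Qed.

Lemma bdd_ext f g : evt (fun i t => f i t = g i t) -> bdd f -> bdd g.
Proof.
by move=> fg [C fC]; exists C; apply: evt2 fg fC => i t _ ->.
Qed.

Lemma bdd_cst (k : R) : bdd (fun _ _ => k).
Proof. by exists `|k|; apply: evtW. Qed.

Lemma bddD f g : bdd f -> bdd g -> bdd (fun i t => f i t + g i t).
Proof.
move=> [C fC] [D gD]; exists (C + D); apply: evt2 fC gD => i t _ h1 h2.
exact: le_trans (ler_normD _ _) (lerD h1 h2).
Qed.

Lemma bddN f : bdd f -> bdd (fun i t => - f i t).
Proof. by move=> [C fC]; exists C; apply: evt_imp fC => i t _; rewrite normrN. Qed.

Lemma bddB f g : bdd f -> bdd g -> bdd (fun i t => f i t - g i t).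
Proof. by move=> bf bg; apply: bddD bf (bddN _ bg). Qed.

Lemma bddM f g : bdd f -> bdd g -> bdd (fun i t => f i t * g i t).
Proof.
move=> [C fC] [D gD]; exists (C * D); apply: evt2 fC gD => i t _ h1 h2.
by rewrite normrM ler_pM.
Qed.

Lemma bddX n f : bdd f -> bdd (fun i t => f i t ^+ n).
Proof.
move=> bf; elim: n => [|n IH]; first exact: bdd_cst.
by apply: bdd_ext (bddM _ _ bf IH); apply: evtW => i t _; rewrite exprS.
Qed.

Lemma bdd_sin (u : I -> R -> R) : bdd (fun i t => sin (u i t)).
Proof. by exists 1; apply: evtW => i t _; exact: sin_max. Qed.

Lemma bdd_cos (u : I -> R -> R) : bdd (fun i t => cos (u i t)).
Proof. by exists 1; apply: evtW => i t _; exact: cos_max. Qed.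

Lemma small_ext f g : evt (fun i t => f i t = g i t) -> small f -> small g.
Proof. by move=> fg sf e e0; apply: evt2 fg (sf e e0) => i t _ ->. Qed.

Lemma small_bdd f : small f -> bdd f.
Proof. by move=> sf; exists 1; apply: sf. Qed.

Lemma small0 : small (fun _ _ => 0).
Proof. by move=> e e0; apply: evtW => i t _; rewrite normr0 ltW. Qed.

Lemma smallD f g : small f -> small g -> small (fun i t => f i t + g i t).
Proof.
move=> sf sg e e0; have e2 : 0 < e / 2 by rewrite divr_gt0.
apply: evt2 (sf _ e2) (sg _ e2) => i t _ h1 h2.
by rewrite (splitr e); exact: le_trans (ler_normD _ _) (lerD h1 h2).
Qed.

Lemma smallN f : small f -> small (fun i t => - f i t).
Proof. by move=> sf e /sf; apply: evt_imp => i t _; rewrite normrN. Qed.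

Lemma smallB f g : small f -> small g -> small (fun i t => f i t - g i t).
Proof. by move=> sf sg; apply: smallD sf (smallN _ sg). Qed.

Lemma smallM f g : small f -> bdd g -> small (fun i t => f i t * g i t).
Proof.
(* [C] may be negative when the domain is empty, whence the divisor [|C| + 1]. *)
move=> sf [C gC] e e0; have C0 : 0 < `|C| + 1 by rewrite ltr_pwDr.
apply: evt2 (sf (e / (`|C| + 1)) _) gC; last by rewrite divr_gt0.
move=> i t _ h1 h2; rewrite normrM.
have -> : e = e / (`|C| + 1) * (`|C| + 1) by rewrite divfK ?gt_eqF.
by rewrite ler_pM// (le_trans h2)// (le_trans (ler_norm C))// lerDl.
Qed.

Lemma smallMr f g : bdd f -> small g -> small (fun i t => f i t * g i t).
Proof.
move=> bf sg; apply: small_ext (smallM _ _ sg bf).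
by apply: evtW => i t _; rewrite mulrC.
Qed.

Lemma smallZ (k : R) f : small f -> small (fun i t => k * f i t).
Proof. exact: smallMr (bdd_cst k). Qed.

Lemma der_ext f g h : evt (fun i t => g i t = h i t) -> der f g -> der f h.
Proof. by apply: evt2 => i t _ ->. Qed.

Lemma derD f f' g g' : der f f' -> der g g' ->
  der (fun i t => f i t + g i t) (fun i t => f' i t + g' i t).
Proof. by apply: evt2 => i t _; exact: is_derive_add. Qed.

Lemma derN f f' : der f f' -> der (fun i t => - f i t) (fun i t => - f' i t).
Proof. by apply: evt_imp => i t _; exact: is_derive_opp. Qed.

Lemma derB f f' g g' : der f f' -> der g g' ->
  der (fun i t => f i t - g i t) (fun i t => f' i t - g' i t).
Proof. by move=> df dg; apply: derD df (derN _ _ dg). Qed.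

Lemma derM f f' g g' : der f f' -> der g g' ->
  der (fun i t => f i t * g i t) (fun i t => f' i t * g i t + f i t * g' i t).
Proof. by apply: evt2 => i t _; exact: is_derive_mul. Qed.

Lemma derC (k : I -> R) : der (fun i _ => k i) (fun _ _ => 0).
Proof. by apply: evtW => i t _; exact: is_derive_const. Qed.

Lemma derZ (k : I -> R) f f' : der f f' ->
  der (fun i t => k i * f i t) (fun i t => k i * f' i t).
Proof.
move=> df; apply: der_ext (derM _ _ _ _ (derC k) df).
by apply: evtW => i t _; rewrite mul0r add0r.
Qed.

Lemma derX n f f' : der f f' ->
  der (fun i t => f i t ^+ n) (fun i t => n%:R * f i t ^+ n.-1 * f' i t).
Proof. by apply: evt_imp => i t _; exact: is_derive_pow. Qed.

Lemma null_ext f g : evt (fun i t => f i t = g i t) -> null f -> null g.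
Proof.
move=> fg [c [c' [dc sc sf]]]; exists c, c'; split => //.
by apply: small_ext sf; apply: evt_imp fg => i t _ ->.
Qed.

Lemma small_null f : small f -> null f.
Proof.
move=> sf; exists (fun _ _ => 0), (fun _ _ => 0); split; first exact: (derC (fun=> 0)).
  exact: small0.
by apply: smallB sf; exact: small0.
Qed.

Lemma nullD f g : null f -> null g -> null (fun i t => f i t + g i t).
Proof.
move=> [c [c' [dc sc sf]]] [b [b' [db sb sg]]].
exists (fun i t => c i t + b i t), (fun i t => c' i t + b' i t); split.
- exact: derD.
- exact: smallD.
- by apply: small_ext (smallD _ _ sf sg); apply: evtW => i t _; ring.
Qed.

Lemma nullZ (k : R) f : null f -> null (fun i t => k * f i t).
Proof.
move=> [c [c' [dc sc sf]]].
exists (fun i t => k * c i t), (fun i t => k * c' i t); split.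
- exact: (derZ (fun=> k)).
- exact: smallZ.
- by apply: small_ext (smallZ k _ sf); apply: evtW => i t _; ring.
Qed.

Lemma nullN f : null f -> null (fun i t => - f i t).
Proof.
move=> nf; apply: null_ext (nullZ (-1) _ nf).
by apply: evtW => i t _; ring.
Qed.

Lemma nullB f g : null f -> null g -> null (fun i t => f i t - g i t).
Proof. by move=> nf ng; apply: nullD nf (nullN _ ng). Qed.

Lemma null_der c c' : der c c' -> small c -> null c'.
Proof.
move=> dc sc; exists c, c'; split => //.
by apply: small_ext small0; apply: evtW => i t _; rewrite subrr.
Qed.

End asymptotics.

(** * Oscillating terms *)

Ltac bounded := repeat first
  [ assumption | exact: bdd_cst | exact: bdd_sin | exact: bdd_cos
  | exact: small_bdd | apply: bddB | apply: bddD | apply: bddN | apply: bddM | apply: bddX ].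

Section oscillation.
Context {R : realType} {I : Type} (om : I -> R) (dom : I -> R -> Prop)
  (A mu : I -> R).
Local Notation evt := (evt om dom).
Local Notation bdd := (bdd om dom).
Local Notation small := (small om dom).
Local Notation der := (der om dom).
Local Notation null := (null om dom).
Context (scale : evt (fun i _ => [/\ 0 < A i, 0 < om i & om i * A i ^+ 2 * mu i = 1]))
  (sA : small (fun i _ => A i)) (smu : small (fun i _ => mu i)).
Implicit Types f g s : I -> R -> R.

(** Rates of order at most [1 / A] for [slow], and at most [A ^- 2] for [fast], which is the rate of
    [est]. Both are upper bounds, so slow quantities are also fast. *)
Definition slow s := bdd s /\
  exists2 s', der s s' & bdd (fun i t => A i * s' i t).
Definition fast f := bdd f /\
  exists2 f', der f f' & bdd (fun i t => A i ^+ 2 * f' i t).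

Lemma slow_fast s : slow s -> fast s.
Proof.
have bA := small_bdd _ _ _ sA.
move=> [bs [s' ds bs']]; split => //; exists s' => //.
apply: bdd_ext (bddM _ _ _ _ bA bs').
by apply: evtW => i t _; rewrite expr2 mulrA.
Qed.

Lemma slowM s1 s2 : slow s1 -> slow s2 -> slow (fun i t => s1 i t * s2 i t).
Proof.
move=> [b1 [d1 e1 c1]] [b2 [d2 e2 c2]]; split; first exact: bddM.
eexists; first exact: derM e1 e2.
apply: bdd_ext (bddD _ _ _ _ (bddM _ _ _ _ c1 b2) (bddM _ _ _ _ b1 c2)).
by apply: evtW => i t _; ring.
Qed.

Lemma slowD s1 s2 : slow s1 -> slow s2 -> slow (fun i t => s1 i t + s2 i t).
Proof.
move=> [b1 [d1 e1 c1]] [b2 [d2 e2 c2]]; split; first exact: bddD.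
eexists; first exact: derD e1 e2.
by apply: bdd_ext (bddD _ _ _ _ c1 c2); apply: evtW => i t _; ring.
Qed.

Lemma slow_cst (k : R) : slow (fun _ _ => k).
Proof.
split; first exact: bdd_cst.
exists (fun _ _ => 0); first exact: (derC _ _ (fun=> k)).
by apply: bdd_ext (bdd_cst _ _ 0); apply: evtW => i t _; ring.
Qed.

Lemma slowB s1 s2 : slow s1 -> slow s2 -> slow (fun i t => s1 i t - s2 i t).
Proof.
move=> h1 h2.
suff -> : (fun i t => s1 i t - s2 i t) = (fun i t => s1 i t + (-1) * s2 i t).
  by apply: slowD h1 (slowM _ _ (slow_cst _) h2).
by apply/funext => i; apply/funext => t; ring.
Qed.

Lemma slow_cos (a : R) : slow (fun _ t => cos (a * t)).
Proof.
have bA := small_bdd _ _ _ sA.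
split; first exact: bdd_cos.
exists (fun _ t => - a * sin (a * t)).
  by apply: evtW => i t _; exact: is_derive_cos_mul.
by bounded.
Qed.

Lemma slow_sin (a : R) : slow (fun _ t => sin (a * t)).
Proof.
have bA := small_bdd _ _ _ sA.
split; first exact: bdd_sin.
exists (fun _ t => a * cos (a * t)).
  by apply: evtW => i t _; exact: is_derive_sin_mul.
by bounded.
Qed.

Lemma fastM f g : fast f -> fast g -> fast (fun i t => f i t * g i t).
Proof.
move=> [b1 [d1 e1 c1]] [b2 [d2 e2 c2]]; split; first exact: bddM.
eexists; first exact: derM e1 e2.
apply: bdd_ext (bddD _ _ _ _ (bddM _ _ _ _ c1 b2) (bddM _ _ _ _ b1 c2)).
by apply: evtW => i t _; ring.
Qed.

(** One integration by parts. As [1 / om = A ^+ 2 * mu], the primitive [f sin / (m om)] is small,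
    and the remainder [f' sin / (m om)] is the bounded [A ^+ 2 * f'] times [mu], up to a bounded
    factor. *)
Lemma null_fast_cos f (m th : R) : m != 0 -> fast f ->
  null (fun i t => f i t * cos (m * om i * t + th)).
Proof.
move=> m0 [bf [f' df bf']]; have bA := small_bdd _ _ _ sA.
exists (fun i t => A i ^+ 2 * mu i / m * (f i t * sin (m * om i * t + th))).
exists (fun i t => A i ^+ 2 * mu i / m * (f' i t * sin (m * om i * t + th)
   + f i t * (m * om i * cos (m * om i * t + th)))); split.
- apply: derZ; apply: derM df _.
  by apply: evtW => i t _; exact: is_derive_sin_affine.
- apply: small_ext (smallM _ _ (fun i _ => mu i)
    (fun i t => A i ^+ 2 / m * (f i t * sin (m * om i * t + th))) smu _).
    by apply: evtW => i t _; ring.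
  by bounded.
- apply: small_ext (smallM _ _ (fun i _ => mu i)
    (fun i t => (A i ^+ 2 * f' i t) / m * sin (m * om i * t + th)) smu _).
    apply: evt_imp scale => i t _ [_ _ e].
    apply/eqP; rewrite -subr_eq0; apply/eqP.
    transitivity ((1 - om i * A i ^+ 2 * mu i) * f i t * cos (m * om i * t + th)).
      by field.
    by rewrite e; ring.
  by bounded.
Qed.

(** Shifting phases by [pi / 2] yields cosines again, so one induction on cosines with arbitrary
    phase is enough below. *)
Lemma cos_mul_sin (u v : R) : cos u * sin v
  = 2^-1 * (cos (v + u - pi / 2) + cos (v - u - pi / 2)).
Proof. by rewrite !cosBpihalf sinD sinB; field. Qed.

(** Abstract form of the equation for [est]: a leading term of order [A ^- 2] with slow amplitude
    [g], everything else being gathered in [e / A]. The hypothesis [smuN] is what ends the repeated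
    integration by parts. *)
Context (d d' g e : I -> R -> R) (la : R) (N : nat).
Context (bd : bdd d) (dd : der d d') (sg : slow g) (be : bdd e)
  (d'E : evt (fun i t => d' i t =
     - (8 * la / A i ^+ 2) * d i t ^+ 2 * g i t * cos (2 * om i * t)
     + (A i)^-1 * e i t))
  (smuN : small (fun i _ => mu i ^+ N / A i)).

Lemma fast_d : fast d.
Proof.
have bA := small_bdd _ _ _ sA.
split=> //; exists d' => //.
apply: bdd_ext (_ : bdd (fun i t =>
  - (8 * la) * d i t ^+ 2 * g i t * cos (2 * om i * t) + A i * e i t)).
  by apply: evt2 d'E scale => i t _ -> [A0 _ _]; field; rewrite gt_eqF.
by have [bg _] := sg; bounded.
Qed.

(* Each integration by parts trades [mu ^+ k / A] for [mu ^+ k.+1 / A], the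
   derivative of [d] being of order [A ^- 2]; since the new factor has even
   frequency 2, the frequency stays odd, hence nonzero. *)
Lemma null_slow_odd n k j s (m : int) (th : R) : (N <= n + k)%N -> slow s ->
  null (fun i t => mu i ^+ k / A i * (s i t * d i t ^+ j)
     * cos ((m * 2 + 1)%:~R * om i * t + th)).
Proof.
have bA := small_bdd _ _ _ sA; have bmu := small_bdd _ _ _ smu.
have [bg _] := sg.
elim: n k j s m th => [|n IH] k j s m th Nk [bs [s' ds bs']].
  (* Here [N <= k], so the amplitude already contains the small factor [mu ^+ N / A]. *)
  apply: small_null; apply: small_ext (smallM _ _ (fun i _ => mu i ^+ N / A i)
    (fun i t => mu i ^+ (k - N) * (s i t * d i t ^+ j) *
      cos ((m * 2 + 1)%:~R * om i * t + th)) smuN _).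
    apply: evtW => i t _; rewrite add0n in Nk.
    by rewrite -[in RHS](subnKC Nk) exprD; ring.
  by bounded.
set M : R := (m * 2 + 1)%:~R.
have M0 : M != 0 by rewrite intr_eq0; apply/eqP; lia.
pose S i t := sin (M * om i * t + th).
(* Only the cosine is integrated: [mu ^+ k / A] divided by [M * om] is [A * mu ^+ k.+1 / M]. *)
pose c i t := A i * mu i ^+ k.+1 / M * ((s i t * d i t ^+ j) * S i t).
pose c' i t := A i * mu i ^+ k.+1 / M * (
  (s' i t * d i t ^+ j + s i t * (j%:R * d i t ^+ j.-1 * d' i t)) * S i t
  + (s i t * d i t ^+ j) * (M * om i * cos (M * om i * t + th))).
have nc : null c'.
  apply: null_der (_ : der c c') _.
    apply: derZ; apply: derM; last first.
      by apply: evtW => i t _; exact: is_derive_sin_affine.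
    by apply: derM ds _; exact: derX.
  apply: small_ext (smallM _ _ (fun i _ => mu i) (fun i t => A i * mu i ^+ k / M *
     ((s i t * d i t ^+ j) * S i t)) smu _).
    by apply: evtW => i t _; rewrite /c exprS; ring.
  by bounded.
(* The parts of [c'] due to [s'] and to [e / A] are of order [1 / A]; the factor [A] of [c]
   compensates this and a factor [mu] is left. *)
have ns : small (fun i t => mu i * (mu i ^+ k / M * (A i * s' i t * d i t ^+ j +
    s i t * j%:R * d i t ^+ j.-1 * e i t) * S i t)).
  by apply: smallM => //; bounded.
have slg : slow (fun i t => s i t * g i t) by apply: slowM => //; split => //; exists s'.
have Nk' : (N <= n + k.+1)%N by rewrite addnS -addSn.
(* The leading part of [d'] multiplies the sine by [cos (2 om t)]: frequencies [M + 2] and [M - 2],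
   amplitude [s * g], and one more power of [d]. *)
have n1 := IH k.+1 j.+1 _ (m + 1) (th - pi / 2) Nk' slg.
have n2 := IH k.+1 j.+1 _ (m - 1) (th - pi / 2) Nk' slg.
have n12 := nullZ _ _ (4 * la * j%:R / M) _ (nullD _ _ _ _ n1 n2).
apply: null_ext (nullD _ _ _ _ (nullB _ _ _ _ nc (small_null _ _ _ ns)) n12).
apply: evt2 scale d'E => i t _ [A0 om0 E] dE.
have -> : (((m + 1) * 2 + 1)%:~R * om i * t + (th - pi / 2) : R)
  = (M * om i * t + th) + 2 * om i * t - pi / 2.
  by rewrite /M !rmorphD !rmorphM /= !rmorphD /=; ring.
have -> : (((m - 1) * 2 + 1)%:~R * om i * t + (th - pi / 2) : R)
  = (M * om i * t + th) - 2 * om i * t - pi / 2.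
  by rewrite /M !rmorphD !rmorphM /= !rmorphB /=; ring.
have pj : j%:R * d i t ^+ j.-1 * d i t ^+ 2 = j%:R * d i t ^+ j.+1.
  case: (j) => [|j']; first by rewrite !mul0r.
  by rewrite -mulrA -exprD addn2.
rewrite -mulrDr -/M.
(* Multiplying by [om * A ^+ 2 * mu = 1] and adding a term that vanishes by [pj] turns the claim
   into an identity of rational functions. *)
transitivity (mu i ^+ k / A i * (s i t * d i t ^+ j) * cos (M * om i * t + th) *
   (om i * A i ^+ 2 * mu i)
  + 8 * la / M * (mu i ^+ k.+1 / A i) * (s i t * g i t) *
   (j%:R * d i t ^+ j.+1 - j%:R * d i t ^+ j.-1 * d i t ^+ 2)
   * (cos (2 * om i * t) * S i t)); last first.
  by rewrite E pj; ring.
rewrite [in RHS]/S cos_mul_sin /c' dE /S.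
have := cos_mul_sin (2 * om i * t) (M * om i * t + th).
set X := cos _ + cos _; set Y := cos (2 * om i * t) => YX.
rewrite -[X](@mulVKf _ 2) ?pnatr_eq0// -YX; clearbody Y.
rewrite !exprS; field.
by rewrite gt_eqF//= -[_ + 1]/(_ + 1%:~R) -[2]/(2%:~R) -intrM -intrD.
Qed.

End oscillation.

(** * The averaged system *)

(* Error coordinates relative to the equilibrium: [pos1], [pos2] are the
   components of [x - x*], [flt] is [nu - F*]; [est] is [d] itself. *)
Record trajectory (R : realType) := Trajectory {
  freq : R; tmin : R; tmax : R;
  pos1 : R -> R; pos2 : R -> R; est : R -> R; flt : R -> R }.
Arguments freq {R}. Arguments tmin {R}. Arguments tmax {R}.
Arguments pos1 {R}. Arguments pos2 {R}. Arguments est {R}. Arguments flt {R}.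

Section system.
Context {R : realType} (w0 al h la H : R) (A : R -> R).
Local Notation traj := (trajectory R).

Definition gap (i : traj) t : R :=
  - (H / 2 * (pos1 i t ^+ 2 + pos2 i t ^+ 2)) - flt i t.
Definition speed (i : traj) t : R :=
  al / A (freq i) * est i t * gap i t * sin (freq i * t)
  + A (freq i) * freq i * cos (freq i * t).
Definition motion (i : traj) (t : R) : Prop :=
  [/\ is_derive t 1 (pos1 i) (speed i t * cos (w0 * t)),
      is_derive t 1 (pos2 i) (speed i t * sin (w0 * t)),
      is_derive t 1 (est i) (la * est i t * (1 - est i t *
        (8 / A (freq i) ^+ 2) * gap i t * cos (2 * freq i * t))) &
      is_derive t 1 (flt i) (h * gap i t)].
End system.

Section averaging.
Context {R : realType} (w0 al h la H d1 d2 Y M : R) (A : R -> R) (N : nat).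
Local Notation traj := (trajectory R).
Definition inbox (i : traj) (t : R) : Prop :=
  [/\ d1 <= est i t <= d2, pos1 i t ^+ 2 + pos2 i t ^+ 2 <= Y & flt i t ^+ 2 <= M].
(** The whole interval is constrained, not only the time [t], so that differential inequalities can
    be integrated from [tmin i]. *)
Definition confined (i : traj) (t : R) : Prop := tmin i <= t <= tmax i /\
  forall u, tmin i <= u <= tmax i -> motion w0 al h la H A i u /\ inbox i u.
Local Notation evt := (evt freq confined).
Local Notation bdd := (bdd freq confined).
Local Notation small := (small freq confined).
Local Notation der := (der freq confined).
Local Notation null := (null freq confined).
Let mu (w : R) := (A w ^+ 2 * w)^-1.
Context (d1gt0 : 0 < d1)
  (Apos : forall w : R, 0 < w -> 0 < A w)
  (sA : small (fun i _ => A (freq i)))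
  (smu : small (fun i _ => mu (freq i)))
  (smuN : small (fun i _ => mu (freq i) ^+ N / A (freq i))).

Let bA : bdd (fun i _ => A (freq i)). Proof. exact: small_bdd. Qed.
Let bmu : bdd (fun i _ => mu (freq i)). Proof. exact: small_bdd. Qed.

Let scale : evt (fun i _ =>
  [/\ 0 < A (freq i), 0 < freq i & freq i * A (freq i) ^+ 2 * mu (freq i) = 1]).
Proof.
exists 0 => i t w0gt _; have A0 := Apos _ w0gt; split => //.
by rewrite /mu; field; rewrite !gt_eqF.
Qed.

Let evt_motion : evt (fun i t => motion w0 al h la H A i t).
Proof. by apply: evtW => i t [ti /(_ t ti)[]]. Qed.
Let evt_box : evt inbox.
Proof. by apply: evtW => i t [ti /(_ t ti)[]]. Qed.

Let sq_bound (x y : R) : x ^+ 2 <= y -> `|x| <= y + 1.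
Proof.
move=> xy; have := sqr_ge0 (`|x| - 1); rewrite sqrrB expr1n mulr1 real_normK ?num_real//.
by have := normr_ge0 x; lra.
Qed.

Lemma bdd_pos1 : bdd pos1.
Proof.
exists (Y + 1); apply: evt_imp evt_box => i t _ [_ y _]; apply: sq_bound.
by have := sqr_ge0 (pos2 i t); lra.
Qed.
Let b1 := bdd_pos1.
Lemma bdd_pos2 : bdd pos2.
Proof.
exists (Y + 1); apply: evt_imp evt_box => i t _ [_ y _]; apply: sq_bound.
by have := sqr_ge0 (pos1 i t); lra.
Qed.
Let b2 := bdd_pos2.
Lemma bdd_flt : bdd flt.
Proof. by exists (M + 1); apply: evt_imp evt_box => i t _ [_ _ y]; exact: sq_bound. Qed.
Let bn := bdd_flt.
Lemma bdd_est : bdd est.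
Proof.
exists d2; apply: evt_imp evt_box => i t _ [/andP[h1 h2] _ _].
by rewrite ger0_norm// (le_trans (ltW d1gt0)).
Qed.
Let bd := bdd_est.
Let d_gt0 : evt (fun i t => 0 < est i t).
Proof. by apply: evt_imp evt_box => i t _ [/andP[h1 h2] _ _]; exact: lt_le_trans h1. Qed.
Let bG : bdd (gap H).
Proof. by rewrite /gap; bounded. Qed.

Let r1 (i : traj) (t : R) := cos (w0 * t).
Let r2 (i : traj) (t : R) := sin (w0 * t).
Let r1' (i : traj) (t : R) := - w0 * sin (w0 * t).
Let r2' (i : traj) (t : R) := w0 * cos (w0 * t).
Let dr1 : der r1 r1'.
Proof. by apply: evtW => i t _; exact: is_derive_cos_mul. Qed.
Let dr2 : der r2 r2'.
Proof. by apply: evtW => i t _; exact: is_derive_sin_mul. Qed.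
Let br1 : bdd r1. Proof. by rewrite /r1; bounded. Qed.
Let br2 : bdd r2. Proof. by rewrite /r2; bounded. Qed.
Let br1' : bdd r1'. Proof. by rewrite /r1'; bounded. Qed.
Let br2' : bdd r2'. Proof. by rewrite /r2'; bounded. Qed.

Let dedither (y r : traj -> R -> R) i t :=
  y i t - A (freq i) * (sin (freq i * t) * r i t).
Let dedither' (r r' : traj -> R -> R) i t :=
  al / A (freq i) * est i t * gap H i t * sin (freq i * t) * r i t
  - A (freq i) * (sin (freq i * t) * r' i t).
Let z1 := dedither pos1 r1.
Let z2 := dedither pos2 r2.

Let der_dedither y r r' : der y (fun i t => speed al H A i t * r i t) -> der r r' ->
  der (dedither y r) (dedither' r r').
Proof.
move=> dy dr; apply: der_ext (_ : der _ (fun i t => speed al H A i t * r i t -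
   A (freq i) * (freq i * cos (freq i * t) * r i t + sin (freq i * t) * r' i t))).
  by apply: evtW => i t _; rewrite /speed /dedither'; ring.
apply: derB => //; apply: derZ; apply: derM => //.
by apply: evtW => i t _; exact: is_derive_sin_mul.
Qed.

Let bdd_dedither y r : bdd y -> bdd r -> bdd (dedither y r).
Proof. by move=> ? ?; rewrite /dedither; bounded. Qed.

Let slow_dedither y r r' : bdd y -> bdd r -> bdd r' ->
  der y (fun i t => speed al H A i t * r i t) -> der r r' ->
  slow freq confined (A \o freq) (dedither y r).
Proof.
move=> by_ br br' dy dr; split; first exact: bdd_dedither.
exists (dedither' r r'); first exact: der_dedither.
apply: bdd_ext (_ : bdd (fun i t => al * est i t * gap H i t * sin (freq i * t) * r i t
  - A (freq i) ^+ 2 * (sin (freq i * t) * r' i t))).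
  by apply: evt_imp scale => i t _ [A0 _ _]; rewrite /dedither' /=; field; rewrite gt_eqF.
by bounded.
Qed.

Let dy1 : der pos1 (fun i t => speed al H A i t * r1 i t).
Proof. by apply: evt_imp evt_motion => i t _ []. Qed.
Let dy2 : der pos2 (fun i t => speed al H A i t * r2 i t).
Proof. by apply: evt_imp evt_motion => i t _ []. Qed.
Let dn : der flt (fun i t => h * gap H i t).
Proof. by apply: evt_imp evt_motion => i t _ []. Qed.

Let sz1 : slow freq confined (A \o freq) z1.
Proof. exact: (slow_dedither _ _ _ _ _ br1'). Qed.
Let sz2 : slow freq confined (A \o freq) z2.
Proof. exact: (slow_dedither _ _ _ _ _ br2'). Qed.
Let sn : slow freq confined (A \o freq) flt.
Proof.
by split => //; exists (fun i t => h * gap H i t) => //=; bounded.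
Qed.
Let sr1 : slow freq confined (A \o freq) r1. Proof. exact: slow_cos. Qed.
Let sr2 : slow freq confined (A \o freq) r2. Proof. exact: slow_sin. Qed.
Let bz1 : bdd z1. Proof. by case: sz1. Qed.
Let bz2 : bdd z2. Proof. by case: sz2. Qed.

(** The gap with [z1], [z2] in place of the position, hence slow, unlike [gap] itself. *)
Let g i t := - (H / 2) * (z1 i t ^+ 2 + z2 i t ^+ 2) - flt i t.
Let zr i t := z1 i t * r1 i t + z2 i t * r2 i t.
Let szr : slow freq confined (A \o freq) zr.
Proof. by apply: slowD; apply: slowM. Qed.
Let sg : slow freq confined (A \o freq) g.
Proof.
rewrite /g; under [X in slow _ _ _ X]eq_fun do under eq_fun do rewrite !expr2.
apply: slowB => //; apply: slowM; first exact: slow_cst.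
by apply: slowD; apply: slowM.
Qed.
Let bzr : bdd zr. Proof. by case: szr. Qed.
Let bg : bdd g. Proof. by case: sg. Qed.

Let G1 i t := - H * sin (freq i * t) * zr i t - H / 2 * A (freq i) * sin (freq i * t) ^+ 2.
(** The expansion of [|z + A sin phi r| ^ 2] is exact, [r] being a unit vector. *)
Let gapE i t : gap H i t = g i t + A (freq i) * G1 i t.
Proof.
rewrite /gap /G1 /g /zr /z1 /z2 /dedither /r1 /r2.
apply/eqP; rewrite -subr_eq0; apply/eqP.
transitivity (H / 2 * (A (freq i) * sin (freq i * t)) ^+ 2 *
  (1 - (cos (w0 * t) ^+ 2 + sin (w0 * t) ^+ 2))); first by field.
by rewrite cos2Dsin2 subrr mulr0.
Qed.
Let bG1 : bdd G1. Proof. by rewrite /G1; bounded. Qed.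
Let d' i t := la * est i t * (1 - est i t * (8 / A (freq i) ^+ 2) * gap H i t
  * cos (2 * freq i * t)).
Let dd : der est d'.
Proof. by apply: evt_imp evt_motion => i t _ []. Qed.
Let e i t := A (freq i) * (la * est i t)
  - 8 * la * est i t ^+ 2 * G1 i t * cos (2 * freq i * t).
Let be : bdd e. Proof. by rewrite /e; bounded. Qed.
Let d'E : evt (fun i t => d' i t =
     - (8 * la / A (freq i) ^+ 2) * est i t ^+ 2 * g i t * cos (2 * freq i * t)
     + (A (freq i))^-1 * e i t).
Proof.
by apply: evt_imp scale => i t _ [A0 _ _]; rewrite /d' /e gapE; field; rewrite gt_eqF.
Qed.

Let null_odd k j s (m : int) (th : R) : slow freq confined (A \o freq) s ->
  null (fun i t => mu (freq i) ^+ k / A (freq i) * (s i t * est i t ^+ j)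
     * cos ((m * 2 + 1)%:~R * freq i * t + th)).
Proof.
apply: (@null_slow_odd _ _ _ _ (A \o freq) (mu \o freq) scale sA smu est d' g e la N
  bd dd sg be d'E smuN N).
exact: leq_addr.
Qed.

Let fd : fast freq confined (A \o freq) est.
Proof. exact: (@fast_d _ _ _ _ (A \o freq) (mu \o freq) scale sA est d' g e la). Qed.

Let cos2E (u : R) : cos (2 * u) = 1 - 2 * sin u ^+ 2.
Proof. by rewrite mulr_natl cos_mulr2n cos2sin2; ring. Qed.

(** The term [al / A * est * g * sin phi] has an odd harmonic and is null. The ripple [A * G1]
    contributes [- al H est zr (sin phi) ^ 2]; the mean one half of the squared sine produces the
    gradient term, and its second harmonic is null. What remains carries a factor [A]. *)
Let null_mean r r' : bdd r' -> slow freq confined (A \o freq) r -> der r r' ->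
  null (fun i t => dedither' r r' i t + al * H / 2 * (est i t * zr i t * r i t)).
Proof.
move=> br' sr dr; have [br _] := sr.
have n1 := nullZ _ _ al _ (null_odd 0 1 _ 0 (- (pi / 2)) (slowM _ _ _ _ _ sg sr)).
have n2 := nullZ _ _ (al * H / 2) _ (@null_fast_cos _ _ _ _ (A \o freq) (mu \o freq)
  scale sA smu _ 2 0 _ (fastM _ _ _ _ _ (fastM _ _ _ _ _ fd (slow_fast _ _ _ sA _ szr))
   (slow_fast _ _ _ sA _ sr))).
have s3 : small (fun i t => A (freq i) * (- (al * H / 2) * est i t * sin (freq i * t) ^+ 3
   * r i t - sin (freq i * t) * r' i t)) by apply: smallM => //; bounded.
apply: null_ext (nullD _ _ _ _ (nullD _ _ _ _ n1 (n2 _)) (small_null _ _ _ s3)).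
  apply: evt_imp scale => i t _ [A0 _ _].
  rewrite cosBpihalf mul0r add0r mul1r addr0 ?expr0 /dedither' gapE /G1 /=.
  by rewrite mulr1z mul1r -[2 * _ * t]mulrA cos2E; field; rewrite gt_eqF.
by rewrite pnatr_eq0.
Qed.

(** The primitives of the null terms are subtracted from [z1] and [z2]. Replacing [zr] by [Zr] on
    the right-hand side then costs a bounded multiple of the small [scr]. *)
Lemma mean_position : exists Z1 Z2 Z1' Z2' : traj -> R -> R,
  [/\ der Z1 Z1', der Z2 Z2',
      small (fun i t => pos1 i t - Z1 i t), small (fun i t => pos2 i t - Z2 i t) &
  let Zr i t := Z1 i t * cos (w0 * t) + Z2 i t * sin (w0 * t) in
  small (fun i t => Z1' i t + al * H / 2 * (est i t * Zr i t * cos (w0 * t))) /\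
  small (fun i t => Z2' i t + al * H / 2 * (est i t * Zr i t * sin (w0 * t)))].
Proof.
have [c1 [c1' [dc1 sc1 sd1]]] := null_mean _ _ br1' sr1 dr1.
have [c2 [c2' [dc2 sc2 sd2]]] := null_mean _ _ br2' sr2 dr2.
exists (fun i t => z1 i t - c1 i t), (fun i t => z2 i t - c2 i t).
exists (fun i t => dedither' r1 r1' i t - c1' i t),
  (fun i t => dedither' r2 r2' i t - c2' i t).
have scr : small (fun i t => c1 i t * r1 i t + c2 i t * r2 i t).
  by apply: smallD; apply: smallM.
split.
- by apply: derB => //; exact: der_dedither.
- by apply: derB => //; exact: der_dedither.
- apply: small_ext (smallD _ _ _ _ (smallM _ _ _ _ sA
    (bddM _ _ _ _ (bdd_sin _ _ (fun i t => freq i * t)) br1)) sc1).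
  by apply: evtW => i t _; rewrite /z1 /dedither; ring.
- apply: small_ext (smallD _ _ _ _ (smallM _ _ _ _ sA
    (bddM _ _ _ _ (bdd_sin _ _ (fun i t => freq i * t)) br2)) sc2).
  by apply: evtW => i t _; rewrite /z2 /dedither; ring.
- split.
  + apply: small_ext (smallB _ _ _ _ (smallN _ _ _ sd1) (smallMr _ _
      (fun i t => al * H / 2 * (est i t * r1 i t)) _ _ scr)); last by bounded.
    by apply: evtW => i t _; rewrite /zr /r1 /r2; ring.
  + apply: small_ext (smallB _ _ _ _ (smallN _ _ _ sd2) (smallMr _ _
      (fun i t => al * H / 2 * (est i t * r2 i t)) _ _ scr)); last by bounded.
    by apply: evtW => i t _; rewrite /zr /r1 /r2; ring.
Qed.

Let sin_sin2 (u : R) : sin u * sin (2 * u) = 2^-1 * (cos u - cos (3 * u)).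
Proof.
have -> : 3 * u = 2 * u + u by ring.
have e2 := cosB (2 * u) u; have e3 : 2 * u - u = u by ring.
by rewrite e3 in e2; rewrite [X in X - _]e2 cosD; field.
Qed.

Let sin_cos2 (u : R) : sin u * cos (2 * u) = 2^-1 * (sin (3 * u) - sin u).
Proof.
have -> : 3 * u = 2 * u + u by ring.
have e2 := sinB (2 * u) u; have e3 : 2 * u - u = u by ring.
by rewrite e3 in e2; rewrite [X in _ - X]e2 sinD; field.
Qed.

Let cos4E (u : R) : cos (4 * u) = 2 * cos (2 * u) ^+ 2 - 1.
Proof.
have -> : 4 * u = (2 * u) *+ 2 by rewrite -mulr_natl; ring.
by rewrite cos_mulr2n; ring.
Qed.

(** The inverse of [est] obeys a linear equation driven by the demodulated gap
    [8 / A ^+ 2 * gap * cos (2 phi)]. Its mean is [H]: the part [- H / 2 A ^ 2 (sin phi) ^ 2] of the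
    gap contributes [H - 2 H cos (2 phi) + H cos (4 phi)]. *)
Lemma mean_estimate : exists Q Q' : traj -> R -> R,
  [/\ der Q Q', small (fun i t => (est i t)^-1 - Q i t) &
    small (fun i t => Q' i t + la * ((est i t)^-1 - H))].
Proof.
pose q' i t := - la * ((est i t)^-1 - 8 / A (freq i) ^+ 2 * gap H i t *
   cos (2 * freq i * t)).
have dq : der (fun i t => (est i t)^-1) q'.
  apply: evt2 dd d_gt0 => i t _ dt d0.
  have e0 : est i t != 0 by rewrite gt_eqF.
  apply: (is_derive_eq (is_derive_inv _ _ _ e0 dt)).
  rewrite /d' /q'; set a := A _; set b := gap _ _ _; set k := cos _.
  rewrite -[8 / _]/(8 * _) ; set v := (a ^+ 2)^-1; clearbody a b k v; field.
  exact: e0.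
suff [c [c' [dc sc sd]]] : null (fun i t => q' i t + la * ((est i t)^-1 - H)).
  exists (fun i t => (est i t)^-1 - c i t), (fun i t => q' i t - c' i t); split.
  - exact: derB.
  - by apply: small_ext sc; apply: evtW => i t _; ring.
  - by apply: small_ext (smallN _ _ _ sd); apply: evtW => i t _; ring.
pose g' i t := - (H / 2) * (2 * z1 i t * dedither' r1 r1' i t +
   2 * z2 i t * dedither' r2 r2' i t) - h * gap H i t.
have dg : der g g'.
  apply: der_ext (derB _ _ _ _ _ _ (derZ _ _ (fun=> - (H / 2)) _ _
   (derD _ _ _ _ _ _ (derX _ _ 2 _ _ (der_dedither _ _ _ dy1 dr1))
      (derX _ _ 2 _ _ (der_dedither _ _ _ dy2 dr2)))) dn).
  by apply: evtW => i t _; rewrite /g' !expr1.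
(* A primitive of the largest term [8 / A ^+ 2 * g * cos (2 phi)], since [mu * freq = A ^- 2]. The
   remainder [4 mu g' sin (2 phi)] has a part of order [mu / A] with harmonics 1 and 3, treated by
   [n1] and [n2], and a small part [s7]. *)
pose c i t := 4 * mu (freq i) * (g i t * sin (2 * freq i * t + 0)).
pose c' i t := 4 * mu (freq i) * (g' i t * sin (2 * freq i * t + 0) +
    g i t * (2 * freq i * cos (2 * freq i * t + 0))).
have nc : null c'.
  apply: null_der (_ : der c c') _.
    apply: derZ; apply: derM => //.
    by apply: evtW => i t _; exact: is_derive_sin_affine.
  apply: small_ext (smallM _ _ _ (fun i t => 4 * (g i t * sin (2 * freq i * t + 0)))
     smu _); last by bounded.
  by apply: evtW => i t _; rewrite /c; ring.
have szrg := slowM _ _ _ _ _ szr sg.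
have n1 := null_odd 1 1 _ 0 0 szrg.
have n2 := null_odd 1 1 _ 1 0 szrg.
(* The cross term [- 8 H / A zr sin phi cos (2 phi)] splits into sines of [3 phi] and [phi]. *)
have n3 := null_odd 0 0 _ 1 (- (pi / 2)) szr.
have n4 := null_odd 0 0 _ 0 (- (pi / 2)) szr.
have f1 := slow_fast _ _ _ sA _ (slow_cst freq confined (A \o freq) 1).
have n5 := @null_fast_cos _ _ _ _ (A \o freq) (mu \o freq)
  scale sA smu _ 2 0 _ f1.
have n6 := @null_fast_cos _ _ _ _ (A \o freq) (mu \o freq)
  scale sA smu _ 4 0 _ f1.
have s7 : small (fun i t => mu (freq i) * (4 * sin (2 * freq i * t) * (
    H * A (freq i) * sin (freq i * t) * (z1 i t * r1' i t + z2 i t * r2' i t)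
    - H * al * zr i t * est i t * G1 i t * sin (freq i * t) - h * gap H i t))).
  by apply: smallM => //; bounded.
apply: null_ext (nullD _ _ _ _ (nullD _ _ _ _ (nullD _ _ _ _
   (nullZ _ _ la _ (nullB _ _ _ _ nc (small_null _ _ _ s7)))
   (nullZ _ _ (2 * H * al * la) _ (nullB _ _ _ _ n1 n2)))
   (nullZ _ _ (- (4 * H * la)) _ (nullB _ _ _ _ n3 n4)))
   (nullD _ _ _ _ (nullZ _ _ (- (2 * H * la)) _ (n5 _)) (nullZ _ _ (H * la) _ (n6 _)))).
2,3: by rewrite pnatr_eq0.
apply: evt_imp scale => i t _ [A0 f0 _].
have -> : (1 * 2 + 1)%:~R * freq i * t = 3 * (freq i * t).
  by rewrite mulrA; congr (_ * _ * _).
have -> : (0 * 2 + 1)%:~R * freq i * t = freq i * t.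
  by rewrite mul0r add0r mulr1z mul1r.
rewrite !cosBpihalf /c' /q' /g' !addr0 /dedither' gapE /G1 -!(mulrA _ (freq i) t) /mu.
set phi := freq i * t.
have -> : sin (3 * phi) = sin phi + 2 * sin phi * cos (2 * phi).
  by rewrite -mulrA sin_cos2; field.
have -> : cos (3 * phi) = cos phi - 2 * sin phi * sin (2 * phi).
  by rewrite -mulrA sin_sin2; field.
rewrite cos4E cos2E; clearbody phi.
move: (sin phi) (cos phi) (sin (2 * phi)) => S C S2.
rewrite /zr; move: (z1 i t) (z2 i t) (r1 i t) (r2 i t) (g i t) (flt i t) (est i t) (est i t)^-1
  => x1 x2 c1 c2 k n d q.
by field; rewrite !gt_eqF.
Qed.

End averaging.

(** * Decay of confined trajectories *)

(** The function [(u - D / c) exp (c (t - s))] has nonpositive derivative. *)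
Lemma gronwall {R : realType} (u u' : R -> R) (s b c D : R) : 0 < c -> 0 <= D ->
  (forall t, s <= t <= b -> is_derive t 1 u (u' t)) ->
  (forall t, s <= t <= b -> u' t <= - c * u t + D) ->
  forall t, s <= t <= b -> u t <= u s * expR (- c * (t - s)) + D / c.
Proof.
move=> c0 D0 du hu t /andP[st tb].
pose v t := (u t - D / c) * expR (c * t - c * s).
pose v' t := (u' t + c * u t - D) * expR (c * t - c * s).
have dv x : s <= x <= b -> is_derive x 1 v (v' x).
  move=> xi; have dx := du _ xi.
  have de := @is_derive1_comp _ (@expR R) (fun t => c * t + - (c * s)) x _ _
    (is_derive_expR _) (is_derive_affine c (- (c * s)) x).
  apply: (is_derive_eq (is_derive_mul _ _ _ _ _ (is_derive_add _ _ _ _ _ dx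
     (is_derive_const (- (D / c)) x)) de)).
  by rewrite /v' /=; field; rewrite gt_eqF.
have cv x : s <= x <= b -> {for x, continuous v}.
  move=> xi; have dx := dv _ xi.
  by apply/differentiable_continuous/derivable1_diffP; exact: (@ex_derive _ _ _ _ _ _ _ dx).
have vd : v t <= v s.
  apply: (@ler0_derive1_le_cc _ v s t) => //; rewrite ?in_itv/= ?lexx ?st//.
  - move=> x /[!in_itv]/= /andP[sx xt].
    have /dv dx : s <= x <= b by rewrite (ltW sx) (le_trans (ltW xt)).
    exact: (@ex_derive _ _ _ _ _ _ _ dx).
  - move=> x /[!in_itv]/= /andP[sx xt].
    have xi : s <= x <= b by rewrite (ltW sx) (le_trans (ltW xt)).
    have dx := dv _ xi.
    rewrite derive1E (@derive_val _ _ _ _ _ _ _ dx) /v' mulr_le0_ge0 ?expR_ge0//.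
    by have := hu _ xi; lra.
  - apply: continuous_in_subspaceT => x /[!inE] /= /[!in_itv]/= /andP[sx xt].
    by apply: cv; rewrite sx (le_trans xt).
have E0 := expR_gt0 (- c * (t - s)).
have : v t * expR (- c * (t - s)) <= v s * expR (- c * (t - s)).
  by rewrite ler_pM2r.
rewrite /v subrr expR0 mulr1 -mulrA -expRD.
have -> : c * t - c * s + - c * (t - s) = 0 by ring.
rewrite expR0 mulr1 mulrBl => h.
have : 0 <= D / c * expR (- c * (t - s)) by exact: mulr_ge0 (divr_ge0 D0 (ltW c0)) (ltW E0).
by lra.
Qed.

(** In the frame turning with the heading, [s' = - a s + w0 m] and [m' = - w0 s]: only [s] is
    damped. The left side is the derivative of [s ^ 2 + m ^ 2 - 2 eps s m], whose cross term
    transfers damping to [m]. The constants are uniform in [a], which will vary with [est]. *)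
Lemma damped_oscillator {R : realType} (w0 a1 a2 : R) : 0 < w0 -> 0 < a1 -> a1 <= a2 ->
  exists eps c : R, [/\ 0 < eps <= 1 / 2, 0 < c & forall a s m, a1 <= a <= a2 ->
    - 2 * a * s ^+ 2 - 2 * eps * (- a * s * m + w0 * m ^+ 2 - w0 * s ^+ 2)
    <= - c * (s ^+ 2 + m ^+ 2 - 2 * eps * (s * m))].
Proof.
move=> w0gt a1gt a12.
(* By Young's inequality the cross term adds at most [eps * k] to the coefficient of [s ^+ 2];
   [eps <= a1 / k] lets the damping absorb it. *)
pose k := 2 * w0 + a2 ^+ 2 / w0.
have k0 : 0 < k.
  by rewrite ltr_wpDr ?mulr_gt0// divr_ge0 ?sqr_ge0// ltW.
pose eps := Num.min (1 / 2) (a1 / k).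
have e0 : 0 < eps by rewrite lt_min !divr_gt0.
have e12 : eps <= 1 / 2 by rewrite ge_min lexx.
have ek : eps * k <= a1.
  by rewrite -ler_pdivlMr// ge_min lexx orbT.
pose c0 := Num.min a1 (eps * w0).
have c0gt : 0 < c0 by rewrite lt_min a1gt mulr_gt0.
(* Since [eps <= 1 / 2], the Lyapunov function is at most [3 / 2] times [s ^ 2 + m ^ 2]. *)
exists eps, (2 / 3 * c0); split; [by rewrite e0|by rewrite mulr_gt0// divr_gt0|].
move=> a s m /andP[ha1 ha2].
have s0 := sqr_ge0 s; have m0 := sqr_ge0 m.
have young : 2 * (a * s * m) <= w0 * m ^+ 2 + a2 ^+ 2 / w0 * s ^+ 2.
  have : a ^+ 2 / w0 * s ^+ 2 <= a2 ^+ 2 / w0 * s ^+ 2.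
    rewrite ler_wpM2r// ler_wpM2r ?invr_ge0 ?(ltW w0gt)//.
    by rewrite ler_pXn2r ?nnegrE//; lra.
  have : 0 <= w0 * (m - a / w0 * s) ^+ 2 by rewrite mulr_ge0 ?sqr_ge0 ?ltW.
  have -> : w0 * (m - a / w0 * s) ^+ 2 = w0 * m ^+ 2 - 2 * (a * s * m)
     + a ^+ 2 / w0 * s ^+ 2 by field; rewrite gt_eqF.
  by lra.
have := ler_wpM2l (ltW e0) young.
have : eps * k * s ^+ 2 <= a1 * s ^+ 2 by rewrite ler_wpM2r.
have : a1 * s ^+ 2 <= a * s ^+ 2 by rewrite ler_wpM2r.
have : c0 * s ^+ 2 <= a1 * s ^+ 2 by rewrite ler_wpM2r// ge_min lexx.
have : c0 * m ^+ 2 <= eps * w0 * m ^+ 2 by rewrite ler_wpM2r// ge_min lexx orbT.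
have : - (2 * eps * (s * m)) <= 1 / 2 * (s ^+ 2 + m ^+ 2).
  have : 0 <= eps * (s + m) ^+ 2 by rewrite mulr_ge0 ?sqr_ge0 ?ltW.
  have : eps * (s ^+ 2 + m ^+ 2) <= 1 / 2 * (s ^+ 2 + m ^+ 2).
    by rewrite ler_wpM2r ?addr_ge0.
  by rewrite sqrrD; nra.
move=> h; have := ler_wpM2l (ltW c0gt) h.
rewrite /k; lra.
Qed.

Section decay.
Context {R : realType} (w0 al h la H d1 d2 Y M : R) (A : R -> R) (N : nat) (eps c : R).
Local Notation traj := (trajectory R).
Local Notation confined := (confined w0 al h la H d1 d2 Y M A).
Local Notation evt := (evt freq confined).
Local Notation bdd := (bdd freq confined).
Local Notation small := (small freq confined).
Local Notation der := (der freq confined).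
Context (d1gt0 : 0 < d1)
  (Apos : forall w : R, 0 < w -> 0 < A w)
  (sA : small (fun i _ => A (freq i)))
  (smu : small (fun i _ => (A (freq i) ^+ 2 * freq i)^-1))
  (smuN : small (fun i _ => (A (freq i) ^+ 2 * freq i)^-1 ^+ N / A (freq i))).
Context (algt0 : 0 < al) (hgt0 : 0 < h) (lagt0 : 0 < la) (Hgt0 : 0 < H) (Ygt0 : 0 < Y).
Context (epsP : 0 < eps <= 1 / 2) (cgt0 : 0 < c)
  (lyapunov : forall a s m : R, al * H / 2 * d1 <= a <= al * H / 2 * d2 ->
    - 2 * a * s ^+ 2 - 2 * eps * (- a * s * m + w0 * m ^+ 2 - w0 * s ^+ 2)
    <= - c * (s ^+ 2 + m ^+ 2 - 2 * eps * (s * m))).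

Let small_le f (D : R) : small f -> 0 < D -> evt (fun i t => - D <= f i t <= D).
Proof. by move=> sf /sf; apply: evt_imp => i t _; rewrite ler_norml. Qed.

Let decay_rate (u u' rho : traj -> R -> R) (k : R) : 0 < k -> der u u' -> small rho ->
  evt (fun i t => u' i t <= - k * u i t + rho i t) ->
  forall D : R, 0 < D ->
  evt (fun i t => u i t <= u i (tmin i) * expR (- k * (t - tmin i)) + D).
Proof.
move=> k0 du sr hu D D0; have kn0 : k != 0 by rewrite gt_eqF.
have Dk : 0 < D * k by rewrite mulr_gt0.
have : evt (fun i t => u' i t <= - k * u i t + D * k).
  by apply: evt2 hu (small_le _ _ sr Dk) => i t _ h1 /andP[_ h2]; lra.
move/(evt_and _ _ _ _ du) => [w hw]; exists w => i t wi [ti ci].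
rewrite -[D in X in _ <= X](mulfK kn0).
apply: (@gronwall _ (u i) (u' i) (tmin i) (tmax i)) => //; first exact: ltW.
- by move=> x xi; have [] := hw i x wi (conj xi ci).
- by move=> x xi; have [] := hw i x wi (conj xi ci).
Qed.

Let at_start (P : traj -> R -> Prop) : evt P -> evt (fun i _ => P i (tmin i)).
Proof.
move=> [w hw]; exists w => i t wi [/andP[ti it] ci]; apply: hw => //; split => //.
by rewrite lexx (le_trans ti).
Qed.

Let after_start : evt (fun i t => tmin i <= t).
Proof. by apply: evtW => i t [/andP[]]. Qed.

(** Gronwall for [Q - H] and [H - Q]. The bound in absolute value expresses decay; the one-sided
    bounds with barrier [k] will keep [est] in the box. *)
Lemma estimate_decay (D : R) : 0 < D ->
  evt (fun i t => `|(est i t)^-1 - H|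
     <= `|(est i (tmin i))^-1 - H| * expR (- la * (t - tmin i)) + D /\
   forall k, 
   (H <= k -> (est i (tmin i))^-1 <= k -> (est i t)^-1 <= k + D) /\
   (k <= H -> k <= (est i (tmin i))^-1 -> k - D <= (est i t)^-1)).
Proof.
have [Q [Q' [dQ sQ sQ']]] := mean_estimate w0 al h la H d1 d2 Y M A N d1gt0 Apos sA smu smuN.
(* Three errors of this size occur: the Gronwall offset, and the distance of [Q] to the inverse of
   [est] at [t] and at [tmin i]. *)
move=> D0; have D4 : 0 < D / 4 by rewrite divr_gt0.
pose rho i t := (Q' i t + la * ((est i t)^-1 - H)) - la * ((est i t)^-1 - Q i t).
have sr : small rho by apply: smallB => //; exact: smallZ.
have up := decay_rate (fun i t => Q i t - H) (fun i t => Q' i t - 0) rho la lagt0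
   (derB _ _ _ _ _ _ dQ (derC _ _ (fun=> H))) sr.
have dn := decay_rate (fun i t => H - Q i t) (fun i t => 0 - Q' i t)
   (fun i t => - rho i t) la lagt0
   (derB _ _ _ _ _ _ (derC _ _ (fun=> H)) dQ) (smallN _ _ _ sr).
have {}up : evt (fun i t => Q i t - H <= (Q i (tmin i) - H) * expR (- la * (t - tmin i)) + D / 4).
  by apply: up => //; apply: evtW => i t _; rewrite /rho; lra.
have {}dn : evt (fun i t => H - Q i t <= (H - Q i (tmin i)) * expR (- la * (t - tmin i)) + D / 4).
  by apply: dn => //; apply: evtW => i t _; rewrite /rho; lra.
apply: evt2 (evt_and _ _ _ _ up dn) (evt_and _ _ _ _ after_start (evt_and _ _ _ _
  (small_le _ _ sQ D4) (at_start _ (small_le _ _ sQ D4)))).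
move=> i t _ [{}up {}dn] [it [/andP[a1 a2] /andP[b1 b2]]].
set E := expR _ in up dn *.
have E0 : 0 < E by exact: expR_gt0.
have E1 : E <= 1.
  by rewrite -expR0 ler_expR mulNr oppr_le0 mulr_ge0 ?subr_ge0// ltW.
set q0 := (est i (tmin i))^-1 in b1 b2 *.
have c1 : (Q i (tmin i) - q0) * E <= D / 4.
  have : (Q i (tmin i) - q0) * E <= D / 4 * E by rewrite ler_pM2r//; lra.
  have : D / 4 * E <= D / 4 * 1 by rewrite ler_pM2l.
  by lra.
have c2 : (q0 - Q i (tmin i)) * E <= D / 4.
  have : (q0 - Q i (tmin i)) * E <= D / 4 * E by rewrite ler_pM2r//; lra.
  have : D / 4 * E <= D / 4 * 1 by rewrite ler_pM2l.
  by lra.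
split.
  have := ler_wpM2r (ltW E0) (ler_norm (q0 - H)).
  have := ler_wpM2r (ltW E0) (ler_norm (H - q0)).
  rewrite (distrC H) => n1 n2; rewrite ler_norml; apply/andP; split; lra.
move=> k; split => hk hq.
  have : (q0 - H) * E <= (k - H) * E by rewrite ler_pM2r//; lra.
  have : (k - H) * E <= (k - H) * 1 by rewrite ler_wpM2l//; lra.
  by lra.
have : (H - q0) * E <= (H - k) * E by rewrite ler_pM2r//; lra.
have : (H - k) * E <= (H - k) * 1 by rewrite ler_wpM2l//; lra.
by lra.
Qed.

Let ysq (i : traj) t := pos1 i t ^+ 2 + pos2 i t ^+ 2.

Let amgm (x y : R) : `|2 * (x * y)| <= x ^+ 2 + y ^+ 2.
Proof.
rewrite ler_norml; have := sqr_ge0 (x + y); have := sqr_ge0 (x - y).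
by rewrite sqrrB sqrrD => h1 h2; apply/andP; split; lra.
Qed.

(** The Lyapunov function of [damped_oscillator] at the mean position. As [eps <= 1 / 2], it lies
    between one half and three halves of the squared length, which is close to [ysq]. *)
Lemma position_decay : exists2 V : traj -> R -> R,
  (forall D : R, 0 < D -> evt (fun i t => 
     [/\ 0 <= V i t, V i t <= 3 / 2 * ysq i t + D & ysq i t <= 2 * V i t + D])) &
  exists V' rho, [/\ der V V', small rho & evt (fun i t => V' i t <= - c * V i t + rho i t)].
Proof.
have [Z1 [Z2 [Z1' [Z2' [dZ1 dZ2 sZ1 sZ2 [sZ1' sZ2']]]]]] :=
  mean_position w0 al h la H d1 d2 Y M A N d1gt0 Apos sA smu smuN.
(* Components of the mean position along the heading and orthogonal to it. *)
pose s i t := Z1 i t * cos (w0 * t) + Z2 i t * sin (w0 * t).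
pose m i t := Z2 i t * cos (w0 * t) - Z1 i t * sin (w0 * t).
pose s' i t := Z1' i t * cos (w0 * t) + Z1 i t * (- w0 * sin (w0 * t)) +
  (Z2' i t * sin (w0 * t) + Z2 i t * (w0 * cos (w0 * t))).
pose m' i t := Z2' i t * cos (w0 * t) + Z2 i t * (- w0 * sin (w0 * t)) -
  (Z1' i t * sin (w0 * t) + Z1 i t * (w0 * cos (w0 * t))).
have dcos : der (fun _ t => cos (w0 * t)) (fun _ t => - w0 * sin (w0 * t)).
  by apply: evtW => i t _; exact: is_derive_cos_mul.
have dsin : der (fun _ t => sin (w0 * t)) (fun _ t => w0 * cos (w0 * t)).
  by apply: evtW => i t _; exact: is_derive_sin_mul.
have ds : der s s' by apply: derD; exact: derM.
have dm : der m m' by apply: derB; exact: derM.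
have b1 : bdd pos1 by exact: bdd_pos1.
have b2 : bdd pos2 by exact: bdd_pos2.
have bZ1 : bdd Z1.
  apply: bdd_ext (bddB _ _ _ _ b1 (small_bdd _ _ _ sZ1)).
  by apply: evtW => i t _; ring.
have bZ2 : bdd Z2.
  apply: bdd_ext (bddB _ _ _ _ b2 (small_bdd _ _ _ sZ2)).
  by apply: evtW => i t _; ring.
have bs : bdd s by rewrite /s; bounded.
have bm : bdd m by rewrite /m; bounded.
have smE i t : s i t ^+ 2 + m i t ^+ 2 = Z1 i t ^+ 2 + Z2 i t ^+ 2.
  rewrite -[RHS]mulr1 -(cos2Dsin2 (w0 * t)) /s /m; ring.
have sY : small (fun i t => ysq i t - (Z1 i t ^+ 2 + Z2 i t ^+ 2)).
  apply: small_ext (smallD _ _ _ _ (smallM _ _ _ (fun i t => pos1 i t + Z1 i t) sZ1 _)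
     (smallM _ _ _ (fun i t => pos2 i t + Z2 i t) sZ2 _)).
    by apply: evtW => i t _; rewrite /ysq; ring.
  1,2: by bounded.
pose k := al * H / 2.
(* Residuals of the averaged equations: [s' = - k est s + w0 m + e1] and [m' = - w0 s + e2]. *)
pose e1 i t := (Z1' i t + k * (est i t * s i t * cos (w0 * t))) * cos (w0 * t)
  + (Z2' i t + k * (est i t * s i t * sin (w0 * t))) * sin (w0 * t).
pose e2 i t := (Z2' i t + k * (est i t * s i t * sin (w0 * t))) * cos (w0 * t)
  - (Z1' i t + k * (est i t * s i t * cos (w0 * t))) * sin (w0 * t).
have se1 : small e1 by apply: smallD; apply: smallM => //; bounded.
have se2 : small e2 by apply: smallB; apply: smallM => //; bounded.
pose V i t := s i t * s i t + m i t * m i t - 2 * eps * (s i t * m i t).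
exists V.
  move=> D D0; have D2 : 0 < D / 2 by rewrite divr_gt0.
  apply: evt_imp (small_le _ _ sY D2) => i t _ /andP[h1 h2].
  have h3 := smE i t; move: epsP => /andP[ep0 ep1].
  have h4 : `|2 * (s i t * m i t)| <= s i t ^+ 2 + m i t ^+ 2 by exact: amgm.
  have h5 : `|2 * eps * (s i t * m i t)| <= 1 / 2 * (s i t ^+ 2 + m i t ^+ 2).
    have -> : 2 * eps * (s i t * m i t) = eps * (2 * (s i t * m i t)) by ring.
    by rewrite normrM (gtr0_norm ep0) ler_pM// ltW.
  move: h5; rewrite ler_norml => /andP[h5 h6].
  have := sqr_ge0 (s i t); have := sqr_ge0 (m i t).
  by rewrite /V -!expr2; split; lra.
exists (fun i t => s' i t * s i t + s i t * s' i t + (m' i t * m i t + m i t * m' i t)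
  - 2 * eps * (s' i t * m i t + s i t * m' i t)).
exists (fun i t => e1 i t * (2 * s i t - 2 * eps * m i t)
  + e2 i t * (2 * m i t - 2 * eps * s i t)); split.
- apply: derB; first by apply: derD; exact: derM.
  by apply: (derZ _ _ (fun=> 2 * eps)); exact: derM.
- by apply: smallD; apply: smallM => //; bounded.
- apply: evtW => i t [ti /(_ t ti)[_ [/andP[h1 h2] _ _]]].
  have k0 : 0 < k by rewrite divr_gt0 ?mulr_gt0.
  have := lyapunov (k * est i t) (s i t) (m i t).
  rewrite -/k !ler_pM2l// h1 h2 => /(_ isT).
  have -> : s' i t = - (k * est i t) * s i t + w0 * m i t + e1 i t.
    rewrite -[in RHS](mulr1 (- (k * est i t) * s i t)) -(cos2Dsin2 (w0 * t)).
    by rewrite /s' /e1 [in RHS]/m; move: (s i t) => x; ring.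
  have -> : m' i t = - w0 * s i t + e2 i t.
    by rewrite /m' /e2 /s; ring.
  by rewrite /V; move: (s i t) (m i t) (e1 i t) (e2 i t) => x1 x2 x3 x4; lra.
Qed.

(** The filter is driven by the position, whence the cascade function [U = k V + flt ^ 2]. By
    Young's inequality the drive costs [h H ^ 2 / 4 ysq ^ 2], which inside the box is at most a
    multiple of [ysq]. *)
Lemma joint_decay : exists2 c' : R, 0 < c' & forall D : R, 0 < D ->
  evt (fun i t => let E := expR (- c' * (t - tmin i)) in
    [/\ `|(est i t)^-1 - H| <= `|(est i (tmin i))^-1 - H| * E + D,
       ysq i t <= 3 * ysq i (tmin i) * E + D,
       flt i t ^+ 2 <= (2 * h * H ^+ 2 * Y / c * ysq i (tmin i)
                          + flt i (tmin i) ^+ 2) * E + D &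
       forall k,
       (H <= k -> (est i (tmin i))^-1 <= k -> (est i t)^-1 <= k + D) /\
       (k <= H -> k <= (est i (tmin i))^-1 -> k - D <= (est i t)^-1)]).
Proof.
have [V hV [V' [rho [dV srho hV']]]] := position_decay.
(* Chosen so that half of the dissipation [c k V] equals the cost [h H ^ 2 / 4 Y (2 V)] of the
   drive. *)
pose k := h * H ^+ 2 * Y / c.
have k0 : 0 < k by rewrite divr_gt0 ?mulr_gt0 ?exprn_gt0.
pose c1 := Num.min (c / 2) h.
have c10 : 0 < c1 by rewrite lt_min hgt0 divr_gt0.
pose c' := Num.min la (Num.min c c1).
have c'0 : 0 < c' by rewrite lt_min lagt0 lt_min cgt0.
exists c' => // D D0.
have bn : bdd flt by exact: bdd_flt.
pose U i t := k * V i t + flt i t ^+ 2.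
pose U' i t := k * V' i t + 2%:R * flt i t ^+ 1 * (h * gap H i t).
have dU : der U U'.
  apply: derD; first exact: (derZ _ _ (fun=> k)).
  apply: (derX _ _ 2).
  by apply: evtW => i t [ti /(_ t ti)[[]]].
(* The maximum absorbs the small defect of [ysq <= 2 V]. *)
pose sig i t := k * rho i t + h * H ^+ 2 / 4 * Y * Num.max 0 (ysq i t - 2 * V i t).
have ssig : small sig.
  apply: smallD; apply: smallZ => //.
  move=> e e0; apply: evt_imp (hV e e0) => i t _ [_ _ h2].
  by rewrite ger0_norm ?le_max ?lexx// ge_max (ltW e0); lra.
have hU : evt (fun i t => U' i t <= - c1 * U i t + sig i t).
  apply: evt2 hV' (hV 1 ltr01) => i t [ti /(_ t ti)[_ [_ y _]]] v' [v0 _ _].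
  have y0 : 0 <= ysq i t by rewrite addr_ge0 ?sqr_ge0.
  have m1 : ysq i t - 2 * V i t <= Num.max 0 (ysq i t - 2 * V i t).
    by rewrite le_max lexx orbT.
  have hc1 : c1 * (k * V i t) <= c / 2 * (k * V i t).
    by rewrite ler_wpM2r ?ge_min ?lexx// mulr_ge0// ltW.
  have hc2 : c1 * flt i t ^+ 2 <= h * flt i t ^+ 2.
    by rewrite ler_wpM2r ?sqr_ge0// ge_min lexx orbT.
  have hv := ler_wpM2l (ltW k0) v'.
  have kE : c / 2 * (k * V i t) = h * H ^+ 2 / 4 * Y * (2 * V i t).
    by rewrite /k; field; rewrite gt_eqF.
  have hY : h * H ^+ 2 / 4 * ysq i t ^+ 2 <= h * H ^+ 2 / 4 * (Y * ysq i t).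
    by rewrite ler_wpM2l ?expr2 ?ler_wpM2r// divr_ge0// mulr_ge0 ?mulr_ge0// ltW.
  have hm : h * H ^+ 2 / 4 * Y * (ysq i t - 2 * V i t)
      <= h * H ^+ 2 / 4 * Y * Num.max 0 (ysq i t - 2 * V i t).
    rewrite ler_wpM2l// mulr_ge0 ?(ltW Ygt0)// divr_ge0// mulr_ge0 ?sqr_ge0//.
    exact: ltW.
  have hn : 0 <= h * (flt i t + H / 2 * ysq i t) ^+ 2 by rewrite mulr_ge0 ?sqr_ge0 ?ltW.
  have gE : gap H i t = - (H / 2 * ysq i t) - flt i t by [].
  rewrite /U' /U /sig expr1 gE.
  move: (ysq i t) (V i t) (V' i t) (flt i t) (rho i t) (Num.max _ _)
    v' v0 y0 m1 hc1 hc2 hv kE hY hm hn {y gE}.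
  move=> y v dv n r m _ v0 y0 m1 hc1 hc2 hv kE hY hm hn.
  lra.
(* The position bound accumulates [5 n] and the filter bound [(k + 1) n]. *)
pose n := D / (k + 5).
have n0 : 0 < n by rewrite divr_gt0// addr_gt0.
have nE : k * n + 5 * n = D.
  by rewrite -mulrDl mulrC divfK// gt_eqF// addr_gt0.
have kn0 : 0 < k * n by rewrite mulr_gt0.
have e1 := estimate_decay D D0.
have e2 := decay_rate V V' rho c cgt0 dV srho hV' n n0.
have e3 := decay_rate U U' sig c1 c10 dU ssig hU n n0.
have e4 := evt_and _ _ _ _ (hV n n0) (at_start _ (hV n n0)).
apply: evt2 (evt_and _ _ _ _ e1 (evt_and _ _ _ _ e2 e3)) (evt_and _ _ _ _ after_start e4).
move=> i t _ [[q1 q2] [v1 u1]] [it [[va vb vc] [wa wb wc]]] E.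
have rate r : c' <= r -> expR (- r * (t - tmin i)) <= E.
  by move=> cr; rewrite ler_expR !mulNr lerN2 ler_wpM2r ?subr_ge0.
have E0 : 0 < E by exact: expR_gt0.
have E1 : E <= 1.
  by rewrite -expR0 ler_expR mulNr oppr_le0 mulr_ge0 ?subr_ge0 ?(ltW c'0).
have ra : c' <= la by rewrite ge_min lexx.
have rc : c' <= c by rewrite /c' !ge_min lexx orbT.
have rc1 : c' <= c1 by rewrite ge_min; apply/orP; right; rewrite ge_min lexx orbT.
have v2 : V i t <= V i (tmin i) * E + n.
  by apply: le_trans v1 _; rewrite lerD2r ler_wpM2l// rate.
have v3 : V i (tmin i) * E <= 3 / 2 * ysq i (tmin i) * E + n.
  have := ler_wpM2r (ltW E0) wb; have := ler_wpM2l (ltW n0) E1; lra.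
split => //.
- apply: le_trans q1 _; rewrite lerD2r ler_wpM2l// rate//.
- by lra.
- have U0 : 0 <= U i (tmin i) by rewrite addr_ge0 ?sqr_ge0// mulr_ge0// ltW.
  have u2 : U i t <= U i (tmin i) * E + n.
    by apply: le_trans u1 _; rewrite lerD2r ler_wpM2l// rate.
  have kv3 := ler_wpM2l (ltW k0) v3.
  have kva : 0 <= k * V i t by rewrite mulr_ge0// ltW.
  have y0 : 0 <= k * ysq i (tmin i) * E.
    by rewrite mulr_ge0 ?(ltW E0)// mulr_ge0 ?(ltW k0)// addr_ge0 ?sqr_ge0.
  have -> : 2 * h * H ^+ 2 * Y / c = 2 * k by rewrite /k; field; rewrite gt_eqF.
  by move: u2; rewrite /U; lra.
Qed.

End decay.

(** * Confinement and semi-global decay *)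

(** At the infimum [c] of the times where [0 <= f], continuity gives [f c <= 0], the hypothesis
    improves this to [f c < 0], and continuity again contradicts the choice of [c]. *)
Lemma bootstrap {R : realType} (f : R -> R) (s b : R) :
  (forall t, s <= t <= b -> {for t, continuous f}) -> f s <= 0 ->
  (forall t, s <= t <= b -> (forall u, s <= u <= t -> f u <= 0) -> f t < 0) ->
  forall t, s <= t <= b -> f t < 0.
Proof.
move=> cf fs hf t /andP[st tb]; rewrite ltNge; apply/negP => ft.
pose B := [set u | s <= u <= t /\ 0 <= f u].
have Bt : B t by split; rewrite ?st ?lexx.
have lB : has_lbound B by exists s => u [/andP[]].
have iB : has_inf B by split => //; exists t.
pose c := inf B.
have sc : s <= c by apply: lb_le_inf; [exists t|move=> u [/andP[]]].
have ct : c <= t by apply: ge_inf.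
have cb : s <= c <= b by rewrite sc (le_trans ct).
have neg u : s <= u -> u < c -> f u < 0.
  move=> su uc; rewrite ltNge; apply/negP => fu.
  have : c <= u by apply: ge_inf => //; split => //; rewrite su (le_trans (ltW uc)).
  by rewrite leNgt uc.
have fc0 : f c <= 0.
  rewrite leNgt; apply/negP => fc.
  have [e /= e0 he] : nbhs c (fun x => 0 < f x).
    by have := cvgr_gt _ (cf _ cb) _ fc; apply.
  have [sc'|cs] := ltP s c; last first.
    have es : c = s by apply/eqP; rewrite eq_le sc cs.
    by move: fc; rewrite es ltNge fs.
  pose u := Num.max s (c - e / 2).
  have uc : u < c by rewrite gt_max sc' ltrBlDr ltrDl divr_gt0.
  have su : s <= u by rewrite le_max lexx.
  have : 0 < f u.
    apply: he => /=; rewrite gtr0_norm ?subr_gt0//.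
    have : c - e / 2 <= u by rewrite le_max lexx orbT.
    by lra.
  by rewrite ltNge ltW// neg.
have fc : f c < 0.
  apply: hf => // u /andP[su]; rewrite le_eqVlt => /orP[/eqP->//|uc].
  by rewrite ltW// neg.
have [e /= e0 he] : nbhs c (fun x => f x < 0).
  by have := cvgr_lt _ (cf _ cb) _ fc; apply.
have [u [uB fu] uc] := inf_adherent e0 iB.
have cu : c <= u by apply: ge_inf.
have : f u < 0 by apply: he => /=; rewrite distrC ger0_norm ?subr_ge0// ltrBlDl.
by rewrite ltNge fu.
Qed.

(** From [ln (1 + u) <= u], used for [q / H] and for its inverse. Together with [exp_distance] it
    translates between the inverse of [est] and the coordinate [ln (H * est)]. *)
Lemma ln_distance {R : realType} (q H m : R) : 0 < m -> m <= q -> m <= H ->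
  `|ln (q / H)| <= `|q - H| / m.
Proof.
move=> m0 mq mH.
have q0 : 0 < q by apply: lt_le_trans mq.
have H0 : 0 < H by apply: lt_le_trans mH.
have ratio x y : 0 < x -> m <= y -> ln (x / y) <= `|x - y| / m.
  move=> x0 my; have y0 : 0 < y by apply: lt_le_trans my.
  have -> : x / y = 1 + (x - y) / y by field; rewrite gt_eqF.
  apply: le_trans (le_ln1Dx _) _.
    by rewrite mulrBl divff ?gt_eqF// -[ltLHS]add0r ltrD2r divr_gt0.
  apply: le_trans (_ : `|x - y| / y <= _).
    by rewrite ler_pM2r ?invr_gt0// ler_norm.
  by rewrite ler_wpM2l// lef_pV2.
rewrite ler_norml; apply/andP; split; last exact: ratio.
have := ratio H q H0 mq; rewrite distrC.
have -> : H / q = (q / H)^-1 by rewrite invf_div.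
by rewrite lnV ?posrE ?divr_gt0//; lra.
Qed.

Lemma exp_distance {R : realType} (x r : R) : `|x| <= r ->
  `|expR x - 1| <= `|x| * expR r.
Proof.
move=> xr; have r0 : 0 <= r by apply: le_trans xr.
have er : 1 <= expR r by rewrite -expR0 ler_expR.
have exr : expR x <= expR r by rewrite ler_expR; apply: le_trans xr; exact: ler_norm.
have h1 := expR_ge1Dx x; have h2 := expR_ge1Dx (- x).
have ex := expR_gt0 x.
have h3 : expR x - 1 <= x * expR x.
  have := ler_wpM2l (ltW ex) h2; rewrite -expRD subrr expR0; lra.
have xer : `|x| <= `|x| * expR r by rewrite ler_peMr.
have xee : `|x| * expR x <= `|x| * expR r by rewrite ler_wpM2l.
have h4 : x * expR x <= `|x| * expR x by rewrite ler_wpM2r ?ler_norm// ltW.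
have h5 : - x <= `|x| by rewrite -normrN ler_norm.
by rewrite ler_norml; apply/andP; split; lra.
Qed.

(** * From confinement in a box to bounded initial data *)

Section semiglobal.
Context {R : realType} (w0 al h la H : R) (A : R -> R) (N : nat).
Local Notation traj := (trajectory R).
Definition vanishing (f : R -> R) := forall e : R, 0 < e ->
  exists w : R, forall w', w < w' -> `|f w'| <= e.
Context (w0gt0 : 0 < w0) (algt0 : 0 < al) (hgt0 : 0 < h) (lagt0 : 0 < la) (Hgt0 : 0 < H)
  (Apos : forall w : R, 0 < w -> 0 < A w) (vA : vanishing A)
  (vmu : vanishing (fun w => (A w ^+ 2 * w)^-1))
  (vmuN : vanishing (fun w => (A w ^+ 2 * w)^-1 ^+ N / A w)).

Let vanishing_small (dom : traj -> R -> Prop) f : vanishing f ->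
  small freq dom (fun i _ => f (freq i)).
Proof. by move=> vf e /vf[w hw]; exists w => i t wi _; exact: hw. Qed.

(** Stopping at [b] makes the decay estimates available on an initial segment as soon as the box is
    known to contain that segment. *)
Let cut (i : traj) b := Trajectory R (freq i) (tmin i) b (pos1 i) (pos2 i) (est i) (flt i).

Let ysq (i : traj) t := pos1 i t ^+ 2 + pos2 i t ^+ 2.

(** One continuous function for all faces of the box, so that [bootstrap] applies to them
    together. *)
Let margin d1 d2 Y M (i : traj) t := Num.max (Num.max (est i t - d2) (d1 - est i t))
  (Num.max (ysq i t - Y) (flt i t ^+ 2 - M)).

Let margin_le0 d1 d2 Y M i t : margin d1 d2 Y M i t <= 0 -> inbox d1 d2 Y M i t.
Proof.
rewrite /margin !ge_max !subr_le0 => /andP[/andP[a1 a2] /andP[a3 a4]].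
by split => //; rewrite a1 a2.
Qed.

Let margin_lt0 d1 d2 Y M i t : d1 < est i t < d2 -> ysq i t < Y ->
  flt i t ^+ 2 < M -> margin d1 d2 Y M i t < 0.
Proof. by move=> /andP[a1 a2] a3 a4; rewrite /margin !gt_max !subr_lt0 a1 a2 a3 a4. Qed.

Let margin_continuous d1 d2 Y M i t : motion w0 al h la H A i t ->
  {for t, continuous (margin d1 d2 Y M i)}.
Proof.
have ctn (f : R -> R) a : is_derive t 1 f a -> {for t, continuous f}.
  move=> fa; apply/differentiable_continuous/derivable1_diffP.
  exact: (@ex_derive _ _ _ _ _ _ _ fa).
case=> e1 e2 e3 e4.
have k (x : R) := is_derive_const x t.
apply: continuous_max; apply: continuous_max.
- exact: ctn (is_derive_add _ _ _ _ _ e3 (k (- d2))).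
- exact: ctn (is_derive_add _ _ _ _ _ (k d1) (is_derive_opp _ _ _ e3)).
- exact: ctn (is_derive_add _ _ _ _ _ (is_derive_add _ _ _ _ _
    (is_derive_pow _ _ _ 2 e1) (is_derive_pow _ _ _ 2 e2)) (k (- Y))).
- exact: ctn (is_derive_add _ _ _ _ _ (is_derive_pow _ _ _ 2 e4) (k (- M))).
Qed.

(** The decay estimates, valid inside the box, put the trajectory strictly inside it, so it never
    leaves. [K] and [c] are fixed before the accuracy [D], on which only the frequency threshold
    depends. *)
Lemma box_decay (qa qb E0 : R) : 0 < qa -> qa <= H -> H <= qb -> 0 < E0 ->
  exists K c : R, [/\ 0 < K, 0 < c & forall D, 0 < D -> exists w : R,
  forall i : traj, w < freq i -> tmin i <= tmax i ->
  (forall t, tmin i <= t <= tmax i -> motion w0 al h la H A i t) ->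
  qa <= (est i (tmin i))^-1 <= qb -> ysq i (tmin i) <= E0 -> flt i (tmin i) ^+ 2 <= E0 ->
  let E := expR (- c * (tmax i - tmin i)) in
    [/\ qa / 2 <= (est i (tmax i))^-1,
      `|(est i (tmax i))^-1 - H| <= `|(est i (tmin i))^-1 - H| * E + D,
       ysq i (tmax i) <= 3 * ysq i (tmin i) * E + D &
       flt i (tmax i) ^+ 2 <= (K * ysq i (tmin i) + flt i (tmin i) ^+ 2) * E + D]].
Proof.
move=> qa0 qaH Hqb E00; have qb0 : 0 < qb by lra.
pose d1 := (2 * qb)^-1; pose d2 := (qa / 2)^-1.
have d10 : 0 < d1 by rewrite invr_gt0 mulr_gt0.
have k0 : 0 < al * H / 2 by rewrite divr_gt0 ?mulr_gt0.
have d12 : al * H / 2 * d1 <= al * H / 2 * d2.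
  by rewrite ler_wpM2l ?(ltW k0)// lef_pV2 ?posrE ?mulr_gt0 ?divr_gt0//; lra.
have [eps [c [eP c0 lyap]]] := damped_oscillator w0 _ _ w0gt0 (mulr_gt0 k0 d10) d12.
(* One more than what the decay estimates allow without offset, and likewise for [M]. There is no
   circularity: [K] depends on [Y], and only then is [M] chosen. *)
pose Y := 3 * E0 + 1; have Y0 : 0 < Y by rewrite /Y; lra.
pose K := 2 * h * H ^+ 2 * Y / c.
have K0 : 0 < K by rewrite divr_gt0 ?mulr_gt0 ?exprn_gt0.
pose M := K * E0 + E0 + 1.
pose dom := confined w0 al h la H d1 d2 Y M A.
have [c' c'0 dec] := joint_decay w0 al h la H d1 d2 Y M A N eps c d10 Apos
  (vanishing_small dom _ vA) (vanishing_small dom _ vmu) (vanishing_small dom _ vmuN)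
  algt0 hgt0 lagt0 Hgt0 Y0 eP c0 lyap.
exists K, c'; split => // D D0.
(* Small enough to land strictly inside every face: [1 / 2] for [Y] and [M], [qa / 4] and [qb / 2]
   for the bounds [qa / 2] and [2 qb] on the inverse of [est]. *)
pose D' := Num.min D (Num.min (1 / 2) (Num.min (qa / 4) (qb / 2))).
have D'0 : 0 < D' by rewrite !lt_min D0 !divr_gt0.
have [w hw] := dec D' D'0; exists w => i wi ti mi /andP[qa1 qb1] y1 n1.
have D1 : D' <= D by rewrite ge_min lexx.
have D2 : D' <= 1 / 2 by rewrite /D' !ge_min lexx !orbT.
have D3 : D' <= qa / 4 by rewrite /D' !ge_min lexx !orbT.
have D4 : D' <= qb / 2 by rewrite /D' !ge_min lexx !orbT.
have est0 : 0 < est i (tmin i) by rewrite -invr_gt0; apply: lt_le_trans qa1.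
have strict b : tmin i <= b <= tmax i ->
    (forall u, tmin i <= u <= b -> margin d1 d2 Y M i u <= 0) ->
    let E := expR (- c' * (b - tmin i)) in
    [/\ qa / 2 <= (est i b)^-1, margin d1 d2 Y M i b < 0,
      `|(est i b)^-1 - H| <= `|(est i (tmin i))^-1 - H| * E + D',
       ysq i b <= 3 * ysq i (tmin i) * E + D' &
       flt i b ^+ 2 <= (K * ysq i (tmin i) + flt i (tmin i) ^+ 2) * E + D'].
  move=> /andP[sb bt] hm E.
  have bb : tmin i <= b <= b by rewrite sb lexx.
  have /hw : dom (cut i b) b.
    split => // u /andP[su ub]; split; last by apply: margin_le0; apply: hm; rewrite su.
    by apply: mi; rewrite su (le_trans ub).
  move=> /(_ wi) [h1 h2 h3 h4]; rewrite /= -/E in h1 h2 h3.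
  have {}h2 : ysq i b <= 3 * ysq i (tmin i) * E + D' by exact: h2.
  have {}h3 : flt i b ^+ 2 <= (K * ysq i (tmin i) + flt i (tmin i) ^+ 2) * E + D' by exact: h3.
  have eb : 0 < est i b.
    by have [/andP[+ _] _ _] := margin_le0 _ _ _ _ _ _ (hm b bb); apply: lt_le_trans.
  have qlo : qa - D' <= (est i b)^-1 by apply: (h4 qa).2.
  have qhi : (est i b)^-1 <= qb + D' by apply: (h4 qb).1.
  have E1 : E <= 1.
    by rewrite -expR0 ler_expR mulNr oppr_le0 mulr_ge0 ?subr_ge0 ?(ltW c'0).
  have E00' : 0 < E by exact: expR_gt0.
  have y00 : 0 <= ysq i (tmin i) by rewrite addr_ge0 ?sqr_ge0.
  split => //; first by lra.
  apply: margin_lt0.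
  - rewrite -[est i b]invrK /d1 /d2 !ltf_pV2 ?posrE ?invr_gt0 ?mulr_gt0 ?divr_gt0//.
    by apply/andP; split; lra.
  - have : 3 * ysq i (tmin i) * E <= 3 * E0 * 1 by rewrite ler_pM// ?mulr_ge0 ?(ltW E00')//; lra.
    by rewrite /Y; lra.
  - have : (K * ysq i (tmin i) + flt i (tmin i) ^+ 2) * E <= (K * E0 + E0) * 1.
      have x1 := lerD (ler_wpM2l (ltW K0) y1) n1.
      by rewrite ler_pM// ?(ltW E00')// addr_ge0 ?sqr_ge0// mulr_ge0// ltW.
    by rewrite /M; lra.
have start : margin d1 d2 Y M i (tmin i) <= 0.
  apply/ltW/margin_lt0.
  - rewrite -[est i _]invrK /d1 /d2 !ltf_pV2 ?posrE ?invr_gt0 ?mulr_gt0 ?divr_gt0//.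
    by apply/andP; split; lra.
  - by rewrite /Y; lra.
  - have KE : 0 < K * E0 by rewrite mulr_gt0.
    by rewrite /M; lra.
have stay := bootstrap (margin d1 d2 Y M i) (tmin i) (tmax i)
  (fun t ti => margin_continuous _ _ _ _ _ _ (mi t ti)) start
  (fun t ti ht => let: And5 _ p _ _ _ := strict t ti ht in p).
have te : tmin i <= tmax i <= tmax i by rewrite ti lexx.
move=> E; have [g1 _ g2 g3 g4] := strict _ te (fun u ui => ltW (stay u ui)).
by split; rewrite ?(le_trans g2) ?(le_trans g3) ?(le_trans g4) ?lerD2l.
Qed.

Definition energy (i : traj) t :=
  pos1 i t ^+ 2 + pos2 i t ^+ 2 + flt i t ^+ 2 + ln (H * est i t) ^+ 2.

Lemma energy_decay (E0 : R) : 0 < E0 -> exists C c : R, [/\ 0 < C, 0 < c &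
  forall D, 0 < D -> exists w : R, forall i : traj, w < freq i -> tmin i <= tmax i ->
  (forall t, tmin i <= t <= tmax i -> motion w0 al h la H A i t) ->
  0 < est i (tmin i) -> energy i (tmin i) <= E0 ->
  energy i (tmax i) <= C * energy i (tmin i) * expR (- c * (tmax i - tmin i)) + D].
Proof.
(* Bounds [|ln (H * est)|] at the start, since its square is at most [E0]; hence the initial inverse
   of [est] lies between [qa] and [qb]. *)
move=> E00; pose r := E0 + 1.
have r0 : 0 <= r by rewrite /r; lra.
pose qa := H * expR (- r); pose qb := H * expR r.
have qa0 : 0 < qa by rewrite mulr_gt0 ?expR_gt0.
have qaH : qa <= H by rewrite ler_piMr ?(ltW Hgt0)// -expR0 ler_expR; lra.
have Hqb : H <= qb by rewrite ler_peMr ?(ltW Hgt0)// -expR0 ler_expR.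
have [K [c [K0 c0 dec]]] := box_decay qa qb E0 qa0 qaH Hqb E00.
(* A Lipschitz constant of [ln] above [qa / 2]. *)
pose B := 2 / qa.
have B0 : 0 < B by rewrite divr_gt0.
pose C := 3 + K + 1 + 2 * (B * qb) ^+ 2.
have Bq2 : 0 <= 2 * (B * qb) ^+ 2 by rewrite mulr_ge0 ?sqr_ge0.
exists C, c; split => //; first by rewrite /C; lra.
move=> D D0.
(* Position and filter each contribute [n] and the logarithm [2 B ^ 2 n], where [n <= 1] serves to
   replace [n ^ 2] by [n]. *)
pose n := Num.min 1 (D / (2 + 2 * B ^+ 2)).
have B20 : 0 < 2 + 2 * B ^+ 2 by have := sqr_ge0 B; lra.
have n0 : 0 < n by rewrite lt_min ltr01 divr_gt0.
have nD : (2 + 2 * B ^+ 2) * n <= D.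
  by rewrite mulrC -ler_pdivlMr// ge_min lexx orbT.
have n1 : n <= 1 by rewrite ge_min lexx.
have [w hw] := dec n n0; exists w => i wi ti mi est0 e0.
set s := tmin i in est0 e0 *; set b := tmax i in ti *.
pose x := ln (H * est i s).
have y0 := sqr_ge0 (pos1 i s); have y0' := sqr_ge0 (pos2 i s).
have f0 := sqr_ge0 (flt i s); have x0 := sqr_ge0 x.
have eE : energy i s = ysq i s + flt i s ^+ 2 + x ^+ 2 by [].
have Y0 : 0 <= ysq i s by rewrite addr_ge0.
have xr : `|x| <= r.
  have := sqr_ge0 (`|x| - 1); rewrite sqrrB expr1n mulr1 real_normK ?num_real//.
  by have := normr_ge0 x; rewrite /r; lra.
have qE : (est i s)^-1 = H * expR (- x).
  by rewrite expRN lnK ?posrE ?mulr_gt0// invfM mulVKf// gt_eqF.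
have hq : qa <= (est i s)^-1 <= qb.
  rewrite qE !ler_pM2l// !ler_expR; move: xr; rewrite ler_norml => /andP[? ?].
  by apply/andP; split; lra.
have hy : ysq i s <= E0 by lra.
have hf : flt i s ^+ 2 <= E0 by lra.
have [g1 g2 g3 g4] := hw i wi ti mi hq hy hf.
rewrite -/s -/b in g1 g2 g3 g4; set E := expR _ in g2 g3 g4 *.
have E00' : 0 < E by exact: expR_gt0.
have E1 : E <= 1.
  by rewrite -expR0 ler_expR mulNr oppr_le0 mulr_ge0 ?subr_ge0 ?(ltW c0).
have q0 : `|(est i s)^-1 - H| <= qb * `|x|.
  rewrite qE -[X in _ - X]mulr1 -mulrBr normrM (gtr0_norm Hgt0) /qb -mulrA ler_pM2l//.
  by rewrite mulrC -(normrN x); apply: exp_distance; rewrite normrN.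
have lnb : `|ln (H * est i b)| <= B * (qb * `|x| * E + n).
  have eb : 0 < est i b by rewrite -invr_gt0; apply: lt_le_trans g1; rewrite divr_gt0.
  have -> : ln (H * est i b) = - ln ((est i b)^-1 / H).
    by rewrite -invfM mulrC lnV ?opprK// posrE mulr_gt0.
  rewrite normrN; apply: le_trans (ln_distance _ _ (qa / 2) _ g1 _) _.
  - by rewrite divr_gt0.
  - by lra.
  - rewrite /B mulrC invf_div ler_pM2l ?divr_gt0//.
    by apply: le_trans g2 _; rewrite lerD2r ler_wpM2r// ltW.
have lnb2 : ln (H * est i b) ^+ 2 <= 2 * (B * qb) ^+ 2 * x ^+ 2 * E + 2 * B ^+ 2 * n.
  rewrite -[ln _ ^+ 2]real_normK ?num_real// -[x ^+ 2]real_normK ?num_real//.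
  apply: le_trans (_ : (B * (qb * `|x| * E + n)) ^+ 2 <= _).
    by rewrite ler_pXn2r ?nnegrE// (le_trans _ lnb).
  set k := qb * `|x|.
  have k1 : (k * E) ^+ 2 <= k ^+ 2 * E.
    by rewrite exprMn ler_wpM2l ?sqr_ge0// expr2 ler_piMr// ltW.
  have k2 : n ^+ 2 <= n by rewrite expr2 ler_piMr// ltW.
  have k3 : (k * E + n) ^+ 2 <= 2 * (k ^+ 2 * E) + 2 * n.
    by have := sqr_ge0 (k * E - n); rewrite sqrrB sqrrD; lra.
  rewrite exprMn; have := ler_wpM2l (sqr_ge0 B) k3.
  by rewrite /k !exprMn; lra.
have p1 : 0 <= 2 * (B * qb) ^+ 2 * (ysq i s + flt i s ^+ 2) * E.
  by rewrite mulr_ge0 ?(ltW E00')// mulr_ge0// addr_ge0.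
have p2 : 0 <= (3 + K) * flt i s ^+ 2 * E.
  by rewrite mulr_ge0 ?(ltW E00')// mulr_ge0//; lra.
have p3 : 0 <= (3 + K + 1) * x ^+ 2 * E.
  by rewrite mulr_ge0 ?(ltW E00')// mulr_ge0//; lra.
have p4 : 0 <= ysq i s * E by rewrite mulr_ge0 ?(ltW E00').
have -> : energy i b = ysq i b + flt i b ^+ 2 + ln (H * est i b) ^+ 2 by [].
rewrite eE /C; move: g3 g4 lnb2 p1 p2 p3 p4 nD.
move: (ysq i b) (ysq i s) (ln (H * est i b)) => u1 u2 u3.
by lra.
Qed.

End semiglobal.

(** * The dither scale and Euclidean balls *)

Section vanishing_powers.
Context {R : realType}.
Implicit Types (f g : R -> R) (a k : R).

Lemma vanishing_powR a : 0 < a -> vanishing (fun w : R => w `^ (- a)).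
Proof.
move=> a0 e e0; exists (e^-1 `^ a^-1) => w wW.
rewrite ger0_norm ?powR_ge0// powRN -[leRHS]invrK.
have ei : e^-1 = (e^-1 `^ a^-1) `^ a.
  by rewrite -powRrM mulVf ?gt_eqF// powRr1// invr_ge0 ltW.
have W0 : 0 < e^-1 `^ a^-1 by rewrite powR_gt0// invr_gt0.
have w0 := lt_trans W0 wW.
rewrite lef_pV2 ?posrE ?invr_gt0 ?powR_gt0//.
by rewrite [leLHS]ei ge0_ler_powR ?nnegrE ?(ltW a0) ?(ltW W0) ?(ltW w0) ?ltW.
Qed.

Lemma vanishing_scale k f : vanishing f -> vanishing (fun w => k * f w).
Proof.
move=> vf e e0; have k0 : 0 < `|k| + 1 by rewrite ltr_wpDl.
have [w hw] := vf (e / (`|k| + 1)) (divr_gt0 e0 k0).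
exists w => w' /hw; rewrite ler_pdivlMr// normrM => h; apply: le_trans h.
by rewrite mulrC ler_wpM2l// lerDl.
Qed.

Lemma vanishing_ext f g : (forall w, 0 < w -> f w = g w) -> vanishing f -> vanishing g.
Proof.
move=> fg vf e /vf[w hw]; exists (Num.max 0 w) => w'.
by rewrite gt_max => /andP[w0 /hw]; rewrite fg.
Qed.

Context (al p : R) (algt0 : 0 < al) (p12 : 1 / 2 < p) (p1 : p < 1).
Let A (w : R) := al * w `^ (p - 1).

Lemma dither_gt0 w : 0 < w -> 0 < A w.
Proof. by move=> w0; rewrite mulr_gt0 ?powR_gt0. Qed.

Lemma vanishing_dither : vanishing A.
Proof.
by have := vanishing_scale al _ (vanishing_powR (1 - p) _); rewrite opprB; apply; rewrite subr_gt0.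
Qed.

Let muE w : 0 < w -> (A w ^+ 2 * w)^-1 = al ^- 2 * w `^ (- (2 * p - 1)).
Proof.
move=> w0; have wn0 : w != 0 by rewrite gt_eqF.
have -> : w `^ (- (2 * p - 1)) = (w `^ (p - 1) * w `^ (p - 1) * w)^-1.
  rewrite powRN -[X in _ = (_ * X)^-1](powRr1 (ltW w0)) -!powRD ?wn0 ?implybT//.
  by congr (_ `^ _)^-1; ring.
have := powR_gt0 (p - 1) w0; rewrite /A; set x := _ `^ _ => x0.
by field; rewrite !gt_eqF.
Qed.

Lemma vanishing_scale_ratio : vanishing (fun w => (A w ^+ 2 * w)^-1).
Proof.
apply: (vanishing_ext _ _ _ (vanishing_scale (al ^- 2) _ (vanishing_powR (2 * p - 1) _))).
  by move=> w w0; rewrite muE.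
by have := p12; lra.
Qed.

(** Up to a constant this is [w] to the power [- (N (2 p - 1) - (1 - p))], so any [N] above
    [(1 - p) / (2 p - 1)] will do. *)
Lemma vanishing_scale_power :
  exists N : nat, vanishing (fun w => (A w ^+ 2 * w)^-1 ^+ N / A w).
Proof.
have p2 : 0 < 2 * p - 1 by have := p12; lra.
pose N := Num.bound ((1 - p) / (2 * p - 1)); exists N.
have hN : 1 - p < N%:R * (2 * p - 1).
  by rewrite -ltr_pdivrMr// archi_boundP// divr_ge0 ?(ltW p2)// subr_ge0 (ltW p1).
have a0 : 0 < N%:R * (2 * p - 1) - (1 - p) by rewrite subr_gt0.
apply: vanishing_ext (vanishing_scale (al ^- 2 ^+ N / al) _ (vanishing_powR _ a0)).
move=> w w0; rewrite muE// exprMn /A -(@powR_mulrn _ (w `^ _)) ?powR_ge0// -powRrM.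
have -> : - (N%:R * (2 * p - 1) - (1 - p)) = - (2 * p - 1) * N%:R + - (p - 1) by ring.
have wn0 : w != 0 by rewrite gt_eqF.
rewrite (powRD (_ : (- (2 * p - 1) * N%:R + - (p - 1) == 0) ==> (w != 0))) ?wn0 ?implybT// powRN.
have := powR_gt0 (p - 1) w0; set x := w `^ (p - 1) => x0.
by field; rewrite !gt_eqF// exprn_gt0.
Qed.

End vanishing_powers.

(** * Euclidean balls as bounded neighborhoods of the origin *)

Section euclidean_balls.
Context {R : realType}.
Let sqn (e : 'rV[R]_4) : R := \sum_(i < 4) e ord0 i ^+ 2.

Let coord_le (e : 'rV[R]_4) i : e ord0 i ^+ 2 <= sqn e.
Proof. by rewrite /sqn (bigD1 i)//= lerDl sumr_ge0// => j _; exact: sqr_ge0. Qed.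

Let sqn_continuous : continuous sqn.
Proof.
move=> e.
have co i : {for e, continuous (fun e : 'rV[R]_4 => e ord0 i * e ord0 i)}.
  by apply: continuousM; exact: coord_continuous.
have -> : sqn = fun e => e ord0 0 * e ord0 0 + (e ord0 1 * e ord0 1 +
    (e ord0 2 * e ord0 2 + e ord0 3 * e ord0 3)).
  apply/funext => x; rewrite /sqn !big_ord_recl big_ord0 addr0 -!expr2.
  by congr (x _ _ ^+ 2 + (x _ _ ^+ 2 + (x _ _ ^+ 2 + x _ _ ^+ 2))); exact: val_inj.
apply: (@continuousD _ _ _ (fun e : 'rV[R]_4 => e ord0 0 * e ord0 0)); first exact: co.
apply: (@continuousD _ _ _ (fun e : 'rV[R]_4 => e ord0 1 * e ord0 1)); first exact: co.
by apply: (@continuousD _ _ _ (fun e : 'rV[R]_4 => e ord0 2 * e ord0 2)); exact: co.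
Qed.

Lemma eball0_bnbhd (r : R) : 0 < r -> bnbhd0 (eball0 r).
Proof.
move=> r0; split; last first.
  exists r; split; first exact: num_real.
  move=> M rM e /= er; apply: le_trans (ltW rM).
  rewrite [leLHS]/Num.Def.normr/= mx_normrE (bigmax_le _ (ltW r0))//= => -[i j] _ /=.
  rewrite (ord1 i) -(ler_pXn2r (ltn0Sn 1)) ?nnegrE ?(ltW r0)//.
  by rewrite real_normK ?num_real// (le_trans (coord_le _ _)) ?ltW.
split.
  have -> : eball0 r = sqn @^-1` [set x | x < r ^+ 2] by [].
  by apply: open_comp; [move=> x _; exact: sqn_continuous|exact: open_lt].
split; last by exists r.
(* Connectedness: the ball is a union of segments issued from the origin. *)
have -> : eball0 r = \bigcup_(e in eball0 r) ((fun t : R => t *: e) @` `[0, 1]).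
  apply/seteqP; split => [e er|x [e er [t /= t01 <-]]].
    by exists e => //; exists 1; rewrite ?scale1r//= in_itv/= ler01 lexx.
  rewrite /eball0 /=; apply: le_lt_trans er.
  apply: ler_sum => i _; rewrite mxE exprMn ler_piMl ?sqr_ge0//.
  by move: t01; rewrite in_itv/= => /andP[t0 t1]; rewrite exprn_ile1.
apply: bigcup_connected.
  by exists 0 => e _; exists 0; rewrite ?scale0r//= in_itv/= lexx ler01.
move=> e _; apply: connected_continuous_connected; first exact: segment_connected.
by apply: continuous_subspaceT => t; apply: cvgZl; exact: cvg_id.
Qed.

(** [bounded_set] refers to the largest entry in absolute value; summing four squares gives the
    factor 4. *)
Lemma bounded_eball0 (V : set 'rV[R]_4) : bounded_set V ->
  exists2 E : R, 0 < E & forall e, V e -> sqn e < E.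
Proof.
move=> [M [_ hM]]; have {}hM := hM (`|M| + 1) _.
exists (4 * (`|M| + 1) ^+ 2 + 1); first by rewrite ltr_wpDl// mulr_ge0// sqr_ge0.
move=> e /hM; rewrite ltr_pwDr ?ler_norm//= => /(_ isT) eM.
rewrite ltr_pwDr//; apply: le_trans (_ : \sum_(i < 4) (`|M| + 1) ^+ 2 <= _).
  apply: ler_sum => i _; rewrite -(@real_normK _ (e ord0 i)) ?num_real//.
  rewrite ler_pXn2r ?nnegrE// ?addr_ge0//; apply: le_trans eM.
  rewrite [leRHS]/Num.Def.normr/= mx_normrE.
  by apply/bigmax_geP; right => /=; exists (ord0, i).
by rewrite sumr_const card_ord mulr_natl.
Qed.

End euclidean_balls.

(** * Solutions of the closed loop *)

Section solutions.
Context {R : realType} (w0 alpha h wd H Fs xs1 xs2 p : R).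
Context (algt0 : 0 < alpha) (Hgt0 : 0 < H) (pgt0 : 0 < p).
Context (w t0 T : R) (x1 x2 d nu : R -> R).
Context (wgt0 : 0 < w) (sol : nss_solution w0 alpha h wd H Fs xs1 xs2 p w t0 T x1 x2 d nu).
Let A (w : R) := alpha * w `^ (p - 1).

Definition restriction (s b : R) := Trajectory R w s b
  (fun t => x1 t - xs1) (fun t => x2 t - xs2) d (fun t => nu t - Fs).

(** With [A w = alpha w ^ (p - 1)], the gains of the closed loop become [A w], [alpha / A] and
    [8 / A ^ 2], and [Fs] cancels in the gap. *)
Lemma restriction_motion s b t : t0 < t < T ->
  motion w0 alpha h wd H A (restriction s b) t.
Proof.
move=> tI; have [_ [_ [_ /(_ t tI)]]] := sol.
have k (x : R) := is_derive_const x t.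
have x0 := powR_gt0 (p - 1) wgt0.
have wn0 : w != 0 by rewrite gt_eqF.
have e1 : alpha * w `^ p = A w * w.
  by rewrite /A -mulrA [_ `^ _ * w]mulrC mulr_powRB1// ltW.
have e2 : w `^ (1 - p) = alpha / A w.
  rewrite -opprB powRN /A; field.
  by rewrite !gt_eqF.
have e3 : 8 * w ^+ 2 / (alpha ^+ 2 * w `^ (2 * p)) = 8 / A w ^+ 2.
  have -> : w `^ (2 * p) = (w * w `^ (p - 1)) ^+ 2.
    by rewrite mulr_powRB1 ?(ltW wgt0)// mulrC powRrM powR_mulrn// powR_ge0.
  rewrite /A; field.
  by rewrite wn0 !gt_eqF.
rewrite e1 e2 e3 /motion /speed.
have gE : Fmap Fs H xs1 xs2 (x1 t) (x2 t) - nu t = gap H (restriction s b) t.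
  by rewrite /Fmap /gap /=; ring.
rewrite gE => -[d1 d2 d3 d4]; split.
- by apply: (is_derive_eq (is_derive_add _ _ _ _ _ d1 (k (- xs1)))); rewrite addr0.
- by apply: (is_derive_eq (is_derive_add _ _ _ _ _ d2 (k (- xs2)))); rewrite addr0.
- exact: d3.
- by apply: (is_derive_eq (is_derive_add _ _ _ _ _ d4 (k (- Fs)))); rewrite addr0.
Qed.

Lemma sum_sq_errvec s b t : \sum_(i < 4) errvec H Fs xs1 xs2 x1 x2 d nu t ord0 i ^+ 2
  = energy H (restriction s b) t.
Proof.
by rewrite !big_ord_recl big_ord0 !mxE /= /energy /=; ring.
Qed.

Lemma energy_right_continuous s b :
  energy H (restriction s b) t @[t --> t0^'+] --> energy H (restriction s b) t0.
Proof.
have [tT [[c1 c2 c3 c4] [dpos _]]] := sol.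
have right (f : R -> R) : {within [set t : R | t0 <= t < T], continuous f} ->
    f t @[t --> t0^'+] --> f t0.
  (* A closed segment inside the half-open interval is enough for a right limit at [t0]. *)
  move=> cf; pose m := (t0 + T) / 2; have t0m : t0 < m by rewrite /m; lra.
  have : {within `[t0, m], continuous f}.
    apply: continuous_subspaceW cf => t /=; rewrite in_itv/= => /andP[-> tm].
    by apply: le_lt_trans tm _; rewrite /m; lra.
  by move/(continuous_within_itvP _ t0m) => [].
have sq (f : R -> R) (l : R) : f t @[t --> t0^'+] --> l ->
   f t ^+ 2 @[t --> t0^'+] --> l ^+ 2.
  by move=> fl; under eq_fun do rewrite expr2; rewrite expr2; apply: cvgM.
have d0 : 0 < H * d t0 by rewrite mulr_gt0// dpos// lexx.
apply: cvgD; first (apply: cvgD; first apply: cvgD); apply: sq.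
- by apply: cvgB; [exact: right|exact: cvg_cst].
- by apply: cvgB; [exact: right|exact: cvg_cst].
- by apply: cvgB; [exact: right|exact: cvg_cst].
- apply: (@cvg_comp _ _ _ (fun t => H * d t) (@ln R)); last exact: continuous_ln d0.
  by apply: cvgM; [exact: cvg_cst|exact: right].
Qed.

(* The equations hold only on the open interval, so the decay estimates are
   started slightly after [t0]. *)
Lemma early_time (u E : R) b : t0 < u -> energy H (restriction u b) t0 < E ->
  exists s, [/\ t0 < s, s < u & energy H (restriction u b) s < E].
Proof.
move=> tu eE.
have h1 : \forall s \near t0^'+, energy H (restriction u b) s < E.
  exact: cvgr_lt (energy_right_continuous u b) _ eE.
have /filter_ex[s sP] : \forall s \near t0^'+,
    [/\ t0 < s, s < u & energy H (restriction u b) s < E].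
  near=> s; split; near: s => //; first exact: nbhs_right_gt.
  exact: nbhs_right_lt.
by exists s.
Unshelve. all: by end_near.
Qed.

End solutions.

(** The energy is the squared length of the error vector, so all three properties follow from one
    use of [energy_decay], with Euclidean balls for [Q] and [W]. *)
Theorem theorem1 (R : realType) (w0 alpha h wd H Fs xs1 xs2 p : R) :
  0 < w0 -> 0 < alpha -> 0 < h -> 0 < wd -> 0 < H ->
  1 / 2 < p -> p < 1 ->
  sGPUAS (nss_err_sol w0 alpha h wd H Fs xs1 xs2 p).
Proof.
move=> w00 al0 h0 wd0 H0 p12 p1 B V [[_ [_ [b b0 bB]]] _] [_ /bounded_eball0[E1 E10 VE]].
have p0 : 0 < p by lra.
pose A (w : R) := alpha * w `^ (p - 1).
have [N vN] := vanishing_scale_power alpha p al0 p12 p1.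
(* Dominates the initial energy both on [V] and on the ball chosen for [Q]. *)
pose E0 := E1 + b ^+ 2.
have b20 : 0 < b ^+ 2 by rewrite exprn_gt0.
have E00 : 0 < E0 by rewrite addr_gt0.
have [C [c [C0 c0 dec]]] := energy_decay w0 alpha h wd H A N w00 al0 h0 wd0 H0
  (dither_gt0 alpha p al0) (vanishing_dither alpha p p1)
  (vanishing_scale_ratio alpha p al0 p12) vN E0 E00.
pose rW := C * E0 + E0 + 2.
have CE0 : 0 < C * E0 by rewrite mulr_gt0.
have rW0 : 0 < rW by rewrite /rW; lra.
have rW2 : C * E0 + E0 + 1 < rW ^+ 2.
  have : rW * 2 <= rW * rW by rewrite ler_wpM2l ?(ltW rW0)// /rW; lra.
  by rewrite expr2 /rW; lra.
(* Ensures [C rQ ^ 2 <= b ^ 2 / 4]; with an offset [D] of at most [b ^ 2 / 4], the energy stays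
   below [b ^ 2]. *)
pose rQ := b / (C + 2).
have C2 : 0 < C + 2 by lra.
have rQ0 : 0 < rQ by rewrite divr_gt0.
have rQE : rQ ^+ 2 * (C + 2) ^+ 2 = b ^+ 2 by rewrite -exprMn divfK ?gt_eqF.
have rQ2 : rQ ^+ 2 * (C * 4 + 4) <= b ^+ 2.
  rewrite -rQE ler_wpM2l ?sqr_ge0// sqrrD.
  by have := sqr_ge0 C; lra.
have rQC : 0 < rQ ^+ 2 * C by rewrite mulr_gt0// exprn_gt0.
have rQ20 : 0 < rQ ^+ 2 by rewrite exprn_gt0.
exists (eball0 rQ), (eball0 rW); split.
  split; [exact: eball0_bnbhd| |exact: eball0_bnbhd|].
    by move=> e eQ; apply: bB; apply: lt_trans eQ _; lra.
  by move=> e /VE; rewrite /eball0 /= => /lt_trans; apply; rewrite /E0 in rW2 CE0; lra.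
pose D := Num.min 1 (b ^+ 2 / 4).
have D0 : 0 < D by rewrite lt_min ltr01 divr_gt0.
have D1 : D <= 1 by rewrite ge_min lexx.
have Db : D <= b ^+ 2 / 4 by rewrite ge_min lexx orbT.
have [w1 hw1] := dec D D0.
exists (Num.max 1 w1); first by rewrite lt_max ltr01.
move=> w; rewrite gt_max => /andP[w1' ww1]; have wgt0 : 0 < w by apply: lt_trans w1'.
(* From [1 + c t1 <= exp (c t1)] one gets [C E0 exp (- c t1) <= b ^ 2 / 4]. The announced time is
   [t1 + 1], because the estimate may start as late as [t0 + 1]. *)
pose t1 := 4 * (C * E0) / (b ^+ 2 * c).
have t10 : 0 < t1 by rewrite divr_gt0 ?mulr_gt0.
exists (t1 + 1); first by rewrite addr_ge0// ltW.
move=> t0 T e [x1 [x2 [d [nu [sol eE]]]]].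
have [t0T [_ [dpos _]]] := sol.
have sqE t : t0 <= t < T -> \sum_(i < 4) e t ord0 i ^+ 2
    = energy H (restriction Fs xs1 xs2 w x1 x2 d nu t t) t.
  by move=> tI; rewrite eE//; exact: sum_sq_errvec.
(* [u] limits the delayed start [s]: it is [t] itself for the first two properties and [t0 + 1] for
   the third, which needs a definite duration [t - s]. *)
have bound u t E : t0 < u -> u <= t -> t < T -> E <= E0 ->
    \sum_(i < 4) e t0 ord0 i ^+ 2 < E ->
    exists s, [/\ t0 < s, s < u &
      \sum_(i < 4) e t ord0 i ^+ 2 <= C * E * expR (- c * (t - s)) + D].
  move=> tu ut tT EE; rewrite sqE ?lexx//= => eE0.
  have [s [ts su es]] := early_time _ _ _ _ _ _ _ _ _ H0 _ _ _ _ _ _ _ sol u E t tu eE0.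
  exists s; split => //.
  have tt : t0 <= t < T by rewrite tT (le_trans (ltW tu)).
  rewrite sqE//.
  have st : s <= t by rewrite (le_trans (ltW su)).
  have mo x : s <= x <= t -> motion w0 alpha h wd H A (restriction Fs xs1 xs2 w x1 x2 d nu s t) x.
    move=> /andP[sx xt]; apply: restriction_motion al0 p0 _ _ _ _ _ _ _ wgt0 sol _ _ _ _.
    by rewrite (lt_le_trans ts sx) (le_lt_trans xt).
  have ds : 0 < d s by apply: dpos; apply/andP; split; [exact: ltW|exact: le_lt_trans tT].
  have h1 := hw1 (restriction Fs xs1 xs2 w x1 x2 d nu s t) ww1 st mo ds (ltW (lt_le_trans es EE)).
  apply: le_trans h1 _; rewrite lerD2r ler_wpM2r ?expR_ge0//.
  by rewrite ler_pM2l// ltW.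
have decay_le1 s t : s < t -> expR (- c * (t - s)) <= 1.
  by move=> st; rewrite -expR0 ler_expR mulNr oppr_le0 mulr_ge0 ?subr_ge0 ?(ltW c0) ?(ltW st).
have E10' : E1 <= E0 by rewrite /E0; lra.
have rQE0 : rQ ^+ 2 <= E0 by rewrite /E0; lra.
split.
- move=> /VE e0 t /andP[]; rewrite le_eqVlt => /orP[/eqP <- _|t0t tT].
    by rewrite /eball0 /=; apply: lt_trans e0 _; lra.
  have [s [_ st hs]] := bound t t E1 t0t (lexx t) tT E10' e0.
  rewrite /eball0 /=; apply: le_lt_trans hs _.
  have : C * E1 * expR (- c * (t - s)) <= C * E0 * 1.
    rewrite ler_pM ?expR_ge0 ?decay_le1//; first by rewrite mulr_ge0 ?ltW.
    by rewrite ler_pM2l.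
  by lra.
- move=> e0 t /andP[]; rewrite le_eqVlt => /orP[/eqP <- _|t0t tT].
    by apply: bB; apply: lt_le_trans e0 _; lra.
  have [s [_ st hs]] := bound t t (rQ ^+ 2) t0t (lexx t) tT rQE0 e0.
  apply: bB; apply: le_lt_trans hs _.
  have : C * rQ ^+ 2 * expR (- c * (t - s)) <= C * rQ ^+ 2 * 1.
    by rewrite ler_wpM2l ?decay_le1// mulrC ltW.
  by lra.
- move=> /VE e0 t /andP[t1t tT].
  have t01 : t0 < t0 + 1 by rewrite ltrDl.
  have t0t : t0 + 1 <= t by lra.
  have [s [_ st hs]] := bound (t0 + 1) t E1 t01 t0t tT E10' e0.
  apply: bB; apply: le_lt_trans hs _.
  have ct : c * t1 <= c * (t - s) by rewrite ler_pM2l//; lra.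
  have ctE : c * t1 * b ^+ 2 = 4 * (C * E0) by rewrite /t1; field; rewrite !gt_eqF.
  have ge1 : 1 + c * (t - s) <= expR (c * (t - s)) by exact: expR_ge1Dx.
  set X := expR _ in ge1 *; set Z := expR _.
  have Z0 : 0 < Z by exact: expR_gt0.
  have ZX : Z * X = 1 by rewrite /Z /X -expRD mulNr addNr expR0.
  have h1 : C * E1 * Z <= C * E0 * Z by rewrite ler_pM2r// ler_pM2l.
  have h2 : Z * (c * t1) <= Z * X by rewrite ler_pM2l//; lra.
  have h3 : Z * (c * t1) * b ^+ 2 <= 1 * b ^+ 2 by rewrite ler_pM2r// -ZX.
  have h4 : Z * (c * t1) * b ^+ 2 = 4 * (C * E0 * Z) by rewrite -mulrA ctE; ring.
  by lra.
Qed.
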